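(* Let $\rho:\Gamma\to\mathrm{Sp}(2n,\mathbb R)$ define a generalized Schottky group whose model Schottky intervals in $S^1$ have pairwise disjoint closures, with Schottky intervals $(P_j^\pm,Q_j^\pm)\subset\mathrm{Lag}(\mathbb R^{2n})$, $j=1,\dots,g$, and let $$D=\bigcap_{j=1}^g\Big(\mathbb{RP}^{2n-1}\setminus\big(\mathcal P(P_j^+,Q_j^+)\cup\mathcal P(P_j^-,Q_j^-)\big)\Big).$$ Then the orbit $\rho(\Gamma)D$ is the complement of a Cantor set of projectivized Lagrangian $n$-planes in $\mathbb{RP}^{2n-1}$. This Cantor set is exactly the projectivization of the increasing set of Lagrangians defined by the boundary map $\eta:\partial\Gamma\to\mathrm{Lag}(\mathbb R^{2n})$; that is, $\eta(\partial\Gamma)$ is a Cantor set and $$\rho(\Gamma)D=\mathbb{RP}^{2n-1}\setminus\bigcup_{x\in\partial\Gamma}\mathbb P(\eta(x)).$$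
   Context: Fix $n\ge1$ and a symplectic form $\omega$ on $\mathbb R^{2n}$; $\mathrm{Lag}(\mathbb R^{2n})$ is the space of Lagrangian subspaces. For transverse Lagrangians $P,Q$ let $\sigma_{PQ}(v+w)=-v+w$ for $v\in P,w\in Q$, and $\mathcal B_{PQ}(u,u')=\omega(u,\sigma_{PQ}(u'))$, a nondegenerate symmetric bilinear form of signature $(n,n)$. The Maslov index $\mathsf M(P,L,Q)$ is the index (number of positive minus number of negative squares) of $\mathcal B_{PQ}|_L$. The relation $\overrightarrow{PLQ}$ iff $\mathsf M(P,L,Q)=n$ is a partial cyclic order on $\mathrm{Lag}(\mathbb R^{2n})$, invariant under $\mathrm{Sp}(2n,\mathbb R)$. The interval $(P,Q)$ is $\{L:\overrightarrow{PLQ}\}$, and its opposite is $-(P,Q)=(Q,P)$. On $S^1=\partial\mathbb H^2$ the cyclic order is $\overrightarrow{abc}$ iff $(a,b,c)$ is in counterclockwise order, with the same notation for intervals. A map is increasing if $\overrightarrow{abc}$ implies $\overrightarrow{f(a)f(b)f(c)}$. The positive halfspace is $\mathcal P(P,Q)=\{\ell\in\mathbb{RP}^{2n-1}:\mathcal B_{PQ}|_{\ell\times\ell}>0\}$. Generalized Schottky group with model intervals having disjoint closures: $\Gamma\subset\mathrm{PSL}(2,\mathbb R)$ is freely generated by $A_1,\dots,A_g$ ($g\ge2$), there are $2g$ open intervals $I_j^\pm=(a_j^\pm,b_j^\pm)\subset S^1$ with pairwise disjoint closures such that $A_j(-I_j^-)=I_j^+$ (so $A_jb_j^-=a_j^+$,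 $A_ja_j^-=b_j^+$); there is an increasing map $\xi_0$ from the set of endpoints of these intervals to $\mathrm{Lag}(\mathbb R^{2n})$; and $\rho:\Gamma\to\mathrm{Sp}(2n,\mathbb R)$ is a homomorphism with $\rho(A_j)\xi_0(b_j^-)=\xi_0(a_j^+)$ and $\rho(A_j)\xi_0(a_j^-)=\xi_0(b_j^+)$ for all $j$. The Schottky intervals in $\mathrm{Lag}(\mathbb R^{2n})$ are $(P_j^\pm,Q_j^\pm)=(\xi_0(a_j^\pm),\xi_0(b_j^\pm))$. The boundary map: a point $x\in\partial\Gamma$ is an infinite reduced word in the $A_j^{\pm1}$; let $x^{(k)}\in\Gamma$ be its initial subword of length $k$. Then $\eta(x)=\lim_{k\to\infty}\rho(x^{(k)})(L)$, where $L$ is any Lagrangian in $\bigcap_{j=1}^g\big((Q_j^+,P_j^+)\cap(Q_j^-,P_j^-)\big)$ (the limit exists and does not depend on $L$). *)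

(* Defs.v *)
From HB Require Import structures.
From mathcomp Require Import all_boot all_order all_algebra.
From mathcomp Require Import generic_quotient sesquilinear.
From mathcomp Require Import all_classical all_reals all_analysis.
Import Order.TTheory GRing.Theory Num.Theory.
Import numFieldTopology.Exports.

Set Implicit Arguments.
Unset Strict Implicit.
Unset Printing Implicit Defensive.

Local Open Scope classical_set_scope.
Local Open Scope ring_scope.

Section PSL2.
Variable R : realType.

Record SL2 : Type := MkSL2 { sl2_mx :> 'M[R]_2; _ : \det sl2_mx == 1 }.

HB.instance Definition _ := [isSub for sl2_mx].
HB.instance Definition _ := [Choice of SL2 by <:].

Lemma det_sl2 (A : SL2) : \det A = 1.
Proof. by case: A => A /= /eqP. Qed.

Lemma unit_sl2 (A : SL2) : (A : 'M[R]_2) \in unitmx.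
Proof. by rewrite unitmxE det_sl2 unitr1. Qed.

Fact sl2_one_subproof : \det (1%:M : 'M[R]_2) == 1.
Proof. by rewrite det1. Qed.
Fact sl2_mul_subproof (A B : SL2) : \det (A *m B) == 1.
Proof. by rewrite det_mulmx !det_sl2 mulr1. Qed.
Fact sl2_inv_subproof (A : SL2) : \det (invmx A) == 1.
Proof. by rewrite det_inv det_sl2 invr1. Qed.

Definition sl2_one : SL2 := MkSL2 sl2_one_subproof.
Definition sl2_mul (A B : SL2) : SL2 := MkSL2 (sl2_mul_subproof A B).
Definition sl2_inv (A : SL2) : SL2 := MkSL2 (sl2_inv_subproof A).

Definition sl2_pm (A B : SL2) : bool :=
  ((A : 'M[R]_2) == B) || ((A : 'M[R]_2) == - (B : 'M[R]_2)).

Fact sl2_pm_refl : reflexive sl2_pm.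
Proof. by move=> A; rewrite /sl2_pm eqxx. Qed.
Fact sl2_pm_sym : symmetric sl2_pm.
Proof. by move=> A B; rewrite /sl2_pm eq_sym [X in _ || X]eq_sym eqr_oppLR. Qed.
Fact sl2_pm_trans : transitive sl2_pm.
Proof.
move=> B A C /orP[]/eqP AB /orP[]/eqP BC; rewrite /sl2_pm AB BC ?opprK ?eqxx //.
by rewrite orbT.
by rewrite orbT.
Qed.

Canonical sl2_pm_equiv := EquivRel sl2_pm sl2_pm_refl sl2_pm_sym sl2_pm_trans.

Definition PSL2 : Type := {eq_quot sl2_pm}%qT.
HB.instance Definition _ : EqQuotient _ sl2_pm PSL2 := EqQuotient.on PSL2.
HB.instance Definition _ := Choice.on PSL2.

Local Open Scope quotient_scope.

Definition psl2_one : PSL2 := \pi_PSL2 sl2_one.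
Definition psl2_mul (x y : PSL2) : PSL2 := \pi_PSL2 (sl2_mul (repr x) (repr y)).
Definition psl2_inv (x : PSL2) : PSL2 := \pi_PSL2 (sl2_inv (repr x)).

Lemma repr_piP (A : SL2) :
  ((repr (\pi_PSL2 A) : SL2) : 'M[R]_2) = A \/
  ((repr (\pi_PSL2 A) : SL2) : 'M[R]_2) = - (A : 'M[R]_2).
Proof.
have : repr (\pi_PSL2 A) = A %[mod PSL2] by rewrite reprK.
by move=> /eqmodP /orP[]/eqP; [left|right].
Qed.

Lemma psl2_mul_pi (A B : SL2) :
  psl2_mul (\pi_PSL2 A) (\pi_PSL2 B) = \pi_PSL2 (sl2_mul A B).
Proof.
apply/eqmodP; rewrite /= /sl2_pm /=.
by case: (repr_piP A) => ->; case: (repr_piP B) => ->;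
  rewrite ?mulmxN ?mulNmx ?opprK eqxx ?orbT.
Qed.

Lemma psl2_inv_pi (A : SL2) : psl2_inv (\pi_PSL2 A) = \pi_PSL2 (sl2_inv A).
Proof.
apply/eqmodP; rewrite /= /sl2_pm /=.
case: (repr_piP A) => ->; first by rewrite eqxx.
have UA : -1 *: (A : 'M[R]_2) \in unitmx.
  by rewrite unitmxZ ?unitrN1 ?unit_sl2.
by rewrite -scaleN1r invmxZ // invrN1 scaleN1r eqxx orbT.
Qed.

Lemma eq_pi (A B : SL2) : A = B :> 'M[R]_2 -> \pi_PSL2 A = \pi_PSL2 B.
Proof. by move=> AB; apply/eqmodP; rewrite /= /sl2_pm AB eqxx. Qed.

Fact psl2_mulA : associative psl2_mul.
Proof.
move=> x y z; rewrite -[x]reprK -[y]reprK -[z]reprK.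
rewrite (psl2_mul_pi (repr y)) (psl2_mul_pi (repr x) (repr y)) !psl2_mul_pi.
by apply: eq_pi; rewrite /= mulmxA.
Qed.
Fact psl2_mul1g : left_id psl2_one psl2_mul.
Proof.
move=> x; rewrite -[x]reprK psl2_mul_pi.
by apply: eq_pi; rewrite /= mul1mx.
Qed.
Fact psl2_mulg1 : right_id psl2_one psl2_mul.
Proof.
move=> x; rewrite -[x]reprK psl2_mul_pi.
by apply: eq_pi; rewrite /= mulmx1.
Qed.
Fact psl2_mulVg : left_inverse psl2_one psl2_inv psl2_mul.
Proof.
move=> x; rewrite -[x]reprK psl2_inv_pi psl2_mul_pi.
by apply: eq_pi; rewrite /= mulVmx ?unit_sl2.
Qed.
Fact psl2_mulgV : right_inverse psl2_one psl2_inv psl2_mul.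
Proof.
move=> x; rewrite -[x]reprK psl2_inv_pi psl2_mul_pi.
by apply: eq_pi; rewrite /= mulmxV ?unit_sl2.
Qed.

HB.instance Definition _ := isGroup.Build PSL2
  psl2_mulA psl2_mul1g psl2_mulg1 psl2_mulVg psl2_mulgV.

End PSL2.

Section Circle.
Variable R : realType.

(* Upper half-plane model: the boundary circle of H^2 is R together with the
   point at infinity, represented by None. *)
Definition circle : Type := one_point_compactification R.
HB.instance Definition _ := Topological.on circle.

Definition mobius (A : 'M[R]_2) (x : circle) : circle :=
  match x with
  | Some t => if A 1 0 * t + A 1 1 == 0 then None
              else Some ((A 0 0 * t + A 0 1) / (A 1 0 * t + A 1 1))
  | None => if A 1 0 == 0 then None else Some (A 0 0 / A 1 0)
  end.

Lemma mobiusN (A : 'M[R]_2) : mobius (- A) =1 mobius A.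
Proof.
by move=> [t|] /=; rewrite !mxE ?mulNr -?opprD oppr_eq0 ?mulNr -?opprD invrN
  ?mulNr mulrN opprK.
Qed.

Definition psl2_act (x : PSL2 R) : circle -> circle :=
  mobius (repr x : SL2 R).

Lemma psl2_act_pi (A : SL2 R) : psl2_act (\pi_(PSL2 R) A)%qT =1 mobius A.
Proof. by move=> t; rewrite /psl2_act; case: (repr_piP A) => ->; rewrite ?mobiusN. Qed.

Definition circle_lt (x y : circle) : bool :=
  match x, y with
  | Some s, Some t => s < t
  | Some _, None => true
  | None, _ => false
  end.

(* Seen from the upper half-plane, counterclockwise is the direction of
   increasing reals, so (a, b, c) is counterclockwise iff it is increasing, up
   to a cyclic permutation, for the order of R with infinity on top. *)
Definition ccw (a b c : circle) : bool :=
  [|| circle_lt a b && circle_lt b c,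
      circle_lt b c && circle_lt c a
    | circle_lt c a && circle_lt a b].

Definition circle_interval (a b : circle) : set circle := [set x | ccw a x b].

End Circle.

Section Words.
Variable g : nat.

(* (j, true) stands for the j-th generator, (j, false) for its inverse. *)
Definition letter : Type := ('I_g * bool)%type.
Definition inv_letter (l : letter) : letter := (l.1, ~~ l.2).

Definition reduced (s : seq letter) : bool :=
  sorted (fun l m => m != inv_letter l) s.

Definition boundary : Type :=
  {x : nat -> letter | forall k, x k.+1 != inv_letter (x k)}.

Variables (G : groupType) (A : 'I_g -> G).

Definition letter_val (l : letter) : G := if l.2 then A l.1 else ((A l.1)^-1)%g.

Definition generated_by : set G :=
  [set c | exists s : seq letter, c = (\prod_(l <- s) letter_val l)%g].

Definition free_generators : Prop :=
  forall s : seq letter, reduced s -> s != [::] ->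
    (\prod_(l <- s) letter_val l)%g <> 1%g.

Definition initial_subword (x : boundary) (k : nat) : G :=
  (\prod_(i < k) letter_val (sval x i))%g.

End Words.

Section Grassmannian.
Variables (R : realType) (N : nat).

Definition ortho_proj (L : {vspace 'rV[R]_N}) : 'M[R]_N :=
  let F : 'M[R]_(\dim L, N) := \matrix_(i < \dim L) tnth (vbasis L) i in
  F^T *m invmx (F *m F^T) *m F.

(* The set of all linear subspaces of R^N, i.e. the disjoint union of the
   Grassmannians Gr(k, R^N), topologized by identifying a subspace with the
   matrix of the orthogonal projection onto it. *)
Definition grassmannian : Type := {vspace 'rV[R]_N}.
HB.instance Definition _ := Choice.on grassmannian.
HB.instance Definition _ :=
  Topological.copy grassmannian (initial_topology ortho_proj).

(* N is the dimension of the ambient vector space: this is RP^(N-1). *)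
Definition projective_space : Type := {l : {vspace 'rV[R]_N} | \dim l == 1%N}.

Definition projectivization (L : {vspace 'rV[R]_N}) : set projective_space :=
  [set l | (sval l <= L)%VS].

End Grassmannian.

Definition cantor_set (T : topologicalType) (K : set T) : Prop :=
  exists f : cantor_space -> set_type K,
    [/\ bijective f, continuous f & forall U, open U -> open (f @` U)].

Section Maslov.
Variables (R : realType) (n : nat).
Local Notation V := 'rV[R]_(n + n).

(* Number of positive minus number of negative squares in a diagonalization of
   the symmetric bilinear form B restricted to L; by Sylvester's law of inertia
   this does not depend on the B-orthogonal basis e of L. *)
Definition form_index (B : V -> V -> R) (L : {vspace V}) : int :=
  xget 0 [set s : int | exists e : (\dim L).-tuple V,
    [/\ basis_of L e,
        forall i j, i != j -> B (tnth e i) (tnth e j) = 0 &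
        s = \sum_(i < \dim L) sgz (B (tnth e i) (tnth e i))]].

Variable omega : V -> V -> R.

Definition lagrangian (L : {vspace V}) : Prop :=
  \dim L = n /\ {in L &, forall u v, omega u v = 0}.

Definition symplectic (f : 'End(V)) : Prop :=
  forall u v, omega (f u) (f v) = omega u v.

(* daddv_pi P Q is the projection onto P along Q; it, hence sigma and BPQ, is
   only meaningful when P and Q are transverse. *)
Definition sigma (P Q : {vspace V}) (u : V) : V :=
  - daddv_pi P Q u + daddv_pi Q P u.

Definition BPQ (P Q : {vspace V}) (u u' : V) : R := omega u (sigma P Q u').

Definition maslov (P L Q : {vspace V}) : int := form_index (BPQ P Q) L.

Definition transverse (P Q : {vspace V}) : Prop := (P :&: Q = 0)%VS.

Definition lag_cyc (P L Q : {vspace V}) : Prop :=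
  [/\ lagrangian P, lagrangian L, lagrangian Q, transverse P Q
    & maslov P L Q = n%:Z].

Definition lag_interval (P Q : {vspace V}) : set {vspace V} :=
  [set L | lag_cyc P L Q].

Definition positive_halfspace (P Q : {vspace V}) :
    set (projective_space R (n + n)) :=
  [set l : projective_space R (n + n) |
    forall u : V, u \in sval l -> u != 0 -> 0 < BPQ P Q u u].

End Maslov.

Section Schottky.
Variables (R : realType) (n : nat).
Local Notation V := 'rV[R]_(n + n).
Variables (omega : V -> V -> R) (g : nat) (A : 'I_g -> PSL2 R).
(* The model interval I_j^+ is (a (j, true), b (j, true)) and I_j^- is
   (a (j, false), b (j, false)). *)
Variables (a b : letter g -> circle R) (xi0 : circle R -> {vspace V}).
(* Only the values of rho on the group generated by A are relevant, and only
   the values of xi0 at endpoints of the model intervals. *)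
Variable rho : PSL2 R -> 'End(V).

Definition endpoints : set (circle R) := range a `|` range b.

Definition model_interval (l : letter g) : set (circle R) :=
  circle_interval (a l) (b l).

Record generalized_schottky : Prop := {
  schottky_free : free_generators A;
  schottky_proper : forall l, a l <> b l;
  schottky_disjoint : forall l m, l != m ->
    closure (model_interval l) `&` closure (model_interval m) = set0;
  schottky_pairing : forall j,
    psl2_act (A j) @` circle_interval (b (j, false)) (a (j, false))
      = model_interval (j, true);
  schottky_lagrangian : forall p, endpoints p -> lagrangian omega (xi0 p);
  schottky_increasing : forall p q r,
    endpoints p -> endpoints q -> endpoints r ->
    ccw p q r -> lag_cyc omega (xi0 p) (xi0 q) (xi0 r);
  schottky_symplectic : forall c, generated_by A c -> symplectic omega (rho c);
  schottky_morphism : forall c d, generated_by A c -> generated_by A d ->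
    rho (c * d)%g = (rho c \o rho d)%VF;
  schottky_rho_b : forall j,
    (rho (A j) @: xi0 (b (j, false)))%VS = xi0 (a (j, true));
  schottky_rho_a : forall j,
    (rho (A j) @: xi0 (a (j, false)))%VS = xi0 (b (j, true))
}.

Definition schottky_domain : set (projective_space R (n + n)) :=
  \bigcap_(j in [set: 'I_g])
    ~` (positive_halfspace omega (xi0 (a (j, true))) (xi0 (b (j, true)))
        `|` positive_halfspace omega (xi0 (a (j, false))) (xi0 (b (j, false)))).

Definition schottky_orbit (D : set (projective_space R (n + n))) :
    set (projective_space R (n + n)) :=
  [set l | exists2 c, generated_by A c &
           exists2 d, D d & sval l = (rho c @: sval d)%VS].

Definition base_lagrangians : set {vspace V} :=
  \bigcap_(j in [set: 'I_g])
    (lag_interval omega (xi0 (b (j, true))) (xi0 (a (j, true)))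
     `&` lag_interval omega (xi0 (b (j, false))) (xi0 (a (j, false)))).

(* The limit exists, for every base Lagrangian L, and does not depend on L.
   Since there is a base Lagrangian, this determines eta uniquely. *)
Definition boundary_map (eta : boundary g -> grassmannian R (n + n)) : Prop :=
  [/\ base_lagrangians !=set0,
      forall x, lagrangian omega (eta x) &
      forall x L, base_lagrangians L ->
        ((fun k => (rho (initial_subword A x k) @: L)%VS
            : grassmannian R (n + n)) @ \oo --> eta x)].

End Schottky.

(* Main.v *)
(* For letters l <> m the model intervals I_l and I_m have disjoint closures, so
   the Lagrangian intervals satisfy B_l + B_m < 0 as quadratic forms, where B_l is
   B_PQ for (P, Q) = (P_l, Q_l); by compactness B_l + B_m <= - e |u|^2 for a single
   e > 0. Moreover B_l (rho(l) u) = - B_(l^-1) u. Hence, along a reduced word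
   x = x_0 x_1 .., the forms q_k(u) = B_(x_k)(rho(x_0 .. x_(k-1))^-1 u) satisfy
     q_(k+1)(u) + e |rho(x_0 .. x_k)^-1 u|^2 <= q_k(u),
   and therefore q_k(u) >= 0 for all k if and only if rho(x_0 .. x_k)^-1 u tends
   to 0. The vectors with this property form a linear subspace eta(x), isotropic
   because omega is invariant. It has dimension n: any limit of n-dimensional
   subspaces on which q_j is eventually nonnegative for each j lies in it, and it
   meets Q_(x_0), on which q_0 vanishes, trivially. The same argument shows that such
   subspaces converge to eta(x), which gives both the limit defining the boundary
   map and the continuity of eta.
   A line outside rho(Gamma) D can be pulled back forever through half-spaces
   P(P_(x_k), Q_(x_k)); the letters x_k form a reduced word with q_k > 0 on the
   line for all k, so the line lies in eta(x). *)
From HB Require Import structures.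
Require Import Defs.
From mathcomp Require Import all_boot all_order all_algebra perm sesquilinear.
From mathcomp Require Import all_classical all_reals all_analysis.
From mathcomp Require Import ring lra.
Import Order.TTheory GRing.Theory Num.Theory.
Import numFieldNormedType.Exports.

Set Implicit Arguments.
Unset Strict Implicit.
Unset Printing Implicit Defensive.

Local Open Scope classical_set_scope.
Local Open Scope ring_scope.

(** * Entrywise continuity of differences and matrix products *)

Section MatrixContinuity.
Variables (R : realType) (T : topologicalType).

Lemma continuous_sub (f g : T -> R) :
  continuous f -> continuous g -> continuous (fun t => f t - g t).
Proof. by move=> cf cg t; apply: cvgB; [exact: cf|exact: cg]. Qed.

Lemma mulmx_coord_continuous (m p q : nat)
    (f : T -> 'M[R]_(m, p)) (g : T -> 'M[R]_(p, q)) :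
  (forall i j, continuous (fun t => f t i j)) ->
  (forall i j, continuous (fun t => g t i j)) ->
  forall i j, continuous (fun t => (f t *m g t) i j).
Proof.
move=> cf cg i j t; under eq_fun do rewrite mxE.
apply: cvg_big => [|k _]; first exact: add_continuous.
by apply: cvgM; [exact: cf|exact: cg].
Qed.
End MatrixContinuity.

(** * Bilinear forms on row vectors: bounds, coercivity, Gram-Schmidt *)

Section BilinearForms.
Variables (R : realType) (N : nat).
Local Notation V := 'rV[R]_N.
Implicit Types (B C : V -> V -> R) (u v w : V) (L : {vspace V}).

Definition bilinear_form B : Prop :=
  (forall v, scalar (B^~ v)) /\ (forall u, scalar (B u)).

Definition positive_on B L : Prop := forall u, u \in L -> u != 0 -> 0 < B u u.

Section Theory.
Variable B : V -> V -> R.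
Hypothesis bB : bilinear_form B.

Lemma bformPl c u u' v : B (c *: u + u') v = c * B u v + B u' v.
Proof. exact: bB.1. Qed.
Lemma bformPr c u v v' : B u (c *: v + v') = c * B u v + B u v'.
Proof. exact: bB.2. Qed.
Lemma bformDl u u' v : B (u + u') v = B u v + B u' v.
Proof. by rewrite -[u]scale1r bformPl mul1r scale1r. Qed.
Lemma bformDr u v v' : B u (v + v') = B u v + B u v'.
Proof. by rewrite -[v]scale1r bformPr mul1r scale1r. Qed.
Lemma bform0l v : B 0 v = 0.
Proof. by apply: (addrI (B 0 v)); rewrite -bformDl !addr0. Qed.
Lemma bform0r u : B u 0 = 0.
Proof. by apply: (addrI (B u 0)); rewrite -bformDr !addr0. Qed.
Lemma bformZl c u v : B (c *: u) v = c * B u v.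
Proof. by rewrite -[c *: u]addr0 bformPl bform0l addr0. Qed.
Lemma bformZr c u v : B u (c *: v) = c * B u v.
Proof. by rewrite -[c *: v]addr0 bformPr bform0r addr0. Qed.
Lemma bformNl u v : B (- u) v = - B u v.
Proof. by rewrite -scaleN1r bformZl mulN1r. Qed.
Lemma bformNr u v : B u (- v) = - B u v.
Proof. by rewrite -scaleN1r bformZr mulN1r. Qed.

Lemma bform_suml (I : Type) (r : seq I) (F : I -> V) v :
  B (\sum_(i <- r) F i) v = \sum_(i <- r) B (F i) v.
Proof.
by elim/big_rec2: _ => [|i y1 y2 _ <-]; rewrite ?bform0l // bformDl.
Qed.
Lemma bform_sumr (I : Type) (r : seq I) (F : I -> V) u :
  B u (\sum_(i <- r) F i) = \sum_(i <- r) B u (F i).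
Proof.
by elim/big_rec2: _ => [|i y1 y2 _ <-]; rewrite ?bform0r // bformDr.
Qed.

Lemma formE u v : B u v = \sum_i \sum_j u 0 i * v 0 j * B 'e_i 'e_j.
Proof.
rewrite {1}[u]row_sum_delta bform_suml; apply: eq_bigr => i _.
rewrite {1}[v]row_sum_delta bform_sumr; apply: eq_bigr => j _.
by rewrite bformZl bformZr mulrA.
Qed.

Lemma form_bound : exists2 c, 0 <= c & forall u v, `|B u v| <= c * (`|u| * `|v|).
Proof.
(* The constant sums the absolute values of the Gram matrix; each coordinate is at most the sup
   norm. *)
exists (\sum_i \sum_j `|B 'e_i 'e_j|) => [|u v].
  by apply: sumr_ge0 => i _; apply: sumr_ge0.
have coord (w : V) i : `|w 0 i| <= `|w|.
  rewrite [leRHS]/Num.Def.normr /= mx_normrE.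
  by apply/bigmax_geP; right => /=; exists (0, i).
rewrite formE mulr_suml (le_trans (ler_norm_sum _ _ _)) //.
apply: ler_sum => i _; rewrite mulr_suml (le_trans (ler_norm_sum _ _ _)) //.
apply: ler_sum => j _; rewrite !normrM mulrC ler_wpM2l //.
by rewrite ler_pM ?coord.
Qed.

Lemma form_continuous (T : topologicalType) (f g : T -> V) :
  continuous f -> continuous g -> continuous (fun t => B (f t) (g t)).
Proof.
move=> cf cg t; under eq_fun do rewrite formE.
apply: cvg_big => [|i _]; first exact: add_continuous.
apply: cvg_big => [|j _]; first exact: add_continuous.
apply: cvgM; last exact: cvg_cst.
apply: cvgM.
  exact: (continuous_comp (@cf t) (@coord_continuous _ _ _ 0 i (f t))).
exact: (continuous_comp (@cg t) (@coord_continuous _ _ _ 0 j (g t))).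
Qed.

(** Membership means being fixed by [projv L], a system of linear equations in the coordinates. *)
Lemma vspace_closed L : closed [set u : V | u \in L].
Proof.
pose f (u : V) : V := u - u *m lin1_mx (projv L).
have -> : [set u : V | u \in L] = [set u | forall i, f u 0 i = 0].
  apply/seteqP; split=> u /=.
    by move=> uL i; rewrite /f mul_rV_lin1 /= projv_id // subrr mxE.
  move=> fu0; suff -> : u = projv L u by apply: memv_proj.
  apply/eqP; rewrite -subr_eq0 -[X in _ - X](mul_rV_lin1 (projv L)).
  by apply/eqP/rowP => i; rewrite fu0 mxE.
have -> : [set u | forall i, f u 0 i = 0] = \bigcap_i [set u | f u 0 i = 0].
  by apply/seteqP; split=> u /= h i => [_|]; apply: h.
apply: closed_bigI => i _.
have cf : continuous (fun u : V => f u 0 i).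
  rewrite /f; under eq_fun do rewrite 2!mxE; apply: continuous_sub.
    exact: coord_continuous.
  apply: mulmx_coord_continuous => k j; first exact: coord_continuous.
  exact: cst_continuous.
exact: (closed_comp (fun u _ => cf u) (@closed_eq R 0)).
Qed.

(** The minimum of the form over the compact unit sphere of L serves as e; homogeneity does the
    rest. *)
Lemma positive_on_lower_bound L : positive_on B L ->
  exists2 e, 0 < e & forall u, u \in L -> e * `|u| ^+ 2 <= B u u.
Proof.
move=> Bpos; pose S := [set u : V | u \in L] `&` [set u : V | `|u| = 1].
have [[u0 Su0]|S0] := pselect (S !=set0); last first.
  (* An empty sphere means that L is zero. *)
  exists 1 => // u uL; have [->|u0] := eqVneq u 0.
    by rewrite bform0l // normr0 expr0n mulr0.
  case: S0; exists (`|u|^-1 *: u); split=> /=; first by rewrite memvZ.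
  by rewrite normrZ normfV normr_id mulVf // normr_eq0.
have cS : compact S.
  apply: bounded_closed_compact.
    by exists 1; split=> // x x1 u [_ /= ->]; apply: ltW.
  apply: closedI; first exact: vspace_closed.
  exact: (closed_comp (fun u _ => @norm_continuous _ _ u) (@closed_eq R 1)).
have cB : {within S, continuous (fun u => B u u)}.
  by apply: continuous_subspaceT; apply: form_continuous => u; exact: cvg_id.
have [c /set_mem[/= cL c1] cmin] :=
  compact_EVT_min (ex_intro _ u0 Su0) cS cB.
exists (B c c) => [|u uL].
  by apply: Bpos => //; rewrite -normr_gt0 c1.
have [->|u_neq0] := eqVneq u 0.
  by rewrite (bform0l _) normr0 expr0n mulr0.
have nu : 0 < `|u| by rewrite normr_gt0.
have : B c c <= B (`|u|^-1 *: u) (`|u|^-1 *: u).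
  apply: cmin; apply/mem_set; split=> /=; first by rewrite memvZ.
  by rewrite normrZ normfV normr_id mulVf // normr_eq0.
rewrite bformZl bformZr mulrA -expr2 exprVn mulrC.
by rewrite ler_pdivlMr // exprn_gt0.
Qed.

Hypothesis symB : forall u v, B u v = B v u.

Definition form_orthogonal (es : seq V) := pairwise (fun u v => B u v == 0) es.

(** One Gram-Schmidt step. The list may be linearly dependent, so zero vectors, for which B y y
    cannot be inverted, are treated apart. *)
Lemma form_orthogonal_proj (es : seq V) v : form_orthogonal es ->
  positive_on B <<es>>%VS ->
  exists2 w, v - w \in <<es>>%VS & {in es, forall y, B w y = 0}.
Proof.
elim: es => [_ _|y es IH]; first by exists v; rewrite // subrr mem0v.
rewrite /form_orthogonal /= => /andP[/allP ys os] pos.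
have sS : (<<es>> <= <<y :: es>>)%VS by apply: sub_span => x xs; rewrite inE xs orbT.
have [w vw ws] := IH os (fun u uL => pos u (subvP sS u uL)).
have [y0|y0] := eqVneq y 0.
  exists w; first exact: (subvP sS).
  by move=> z; rewrite inE => /predU1P[->|/ws//]; rewrite y0 bform0r.
have yS : y \in <<y :: es>>%VS by apply: memv_span; rewrite mem_head.
have Byy : B y y != 0 by rewrite gt_eqF // pos.
exists (w - (B w y / B y y) *: y).
  by rewrite opprB addrCA addrC memvD ?memvZ // (subvP sS).
move=> z; rewrite inE => /predU1P[->|zs]; rewrite bformDl bformNl bformZl.
  by rewrite divfK // subrr.
by rewrite ws // (eqP (ys _ zs)) mulr0 subrr.
Qed.

(** Keeping the length of the list ensures that a basis is turned into a basis. *)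
Lemma orthogonal_span (es : seq V) : positive_on B <<es>>%VS ->
  exists fs, [/\ size fs = size es, <<fs>>%VS = <<es>>%VS & form_orthogonal fs].
Proof.
elim: es => [|v es IH] pos; first by exists [::].
have sS : (<<es>> <= <<v :: es>>)%VS by apply: sub_span => x xs; rewrite inE xs orbT.
have [fs [sz sp ot]] := IH (fun u uL => pos u (subvP sS u uL)).
have [|w vw wt] := @form_orthogonal_proj fs v ot.
  by move=> u; rewrite sp => /(subvP sS); exact: pos.
exists (w :: fs); rewrite /= sz; split=> //; last first.
  by apply/andP; split=> //; apply/allP => y /wt ->.
rewrite !span_cons sp; rewrite sp in vw.
apply/eqP; rewrite eqEsubv !subv_add !addvSr !andbT -!memvE.
rewrite -{1}[w](subrK v) addrC -opprB memv_add ?memv_line ?memvN //=.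
by rewrite -{1}[v](subrK w) addrC memv_add ?memv_line.
Qed.

Lemma orthogonal_basis L : positive_on B L ->
  exists2 e : (\dim L).-tuple V, basis_of L e &
    forall i j, i != j -> B (tnth e i) (tnth e j) = 0.
Proof.
move=> pos; have spL : <<vbasis L>>%VS = L by exact: span_basis (vbasisP L).
have [|t [sz sp ot]] := @orthogonal_span (vbasis L); first by rewrite spL.
rewrite size_tuple in sz; have szt : size t == \dim L by rewrite sz.
exists (Tuple szt).
  by rewrite basisEdim /= sp spL subvv sz leqnn.
have ot_lt (i j : 'I_(\dim L)) : (i < j)%N -> B (tnth (Tuple szt) i) (tnth (Tuple szt) j) = 0.
  move=> ij; rewrite !(tnth_nth 0) /=; apply/eqP.
  by have /(pairwiseP 0) := ot; apply; rewrite ?inE ?sz.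
move=> i j; rewrite neq_ltn => /orP[/ot_lt //|/ot_lt].
by rewrite symB.
Qed.

End Theory.
End BilinearForms.

(** * Maximal index and positivity *)

Section FormIndex.
Variables (R : realType) (n : nat).
Local Notation V := 'rV[R]_(n + n).
Implicit Types (B : V -> V -> R) (L : {vspace V}).

(** All signs are 1 in any orthogonal basis, and Gram-Schmidt provides one, so [xget] never falls
    back on its default. *)
Lemma form_index_positive B L : bilinear_form B ->
  (forall u v, B u v = B v u) -> positive_on B L -> form_index B L = (\dim L)%:Z.
Proof.
move=> bB symB pos; rewrite /form_index.
have pos1 (e : (\dim L).-tuple V) : basis_of L e ->
    \sum_(i < \dim L) sgz (B (tnth e i) (tnth e i)) = (\dim L)%:Z.
  move=> be; rewrite (eq_bigr (fun=> 1)) => [|i _].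
    by rewrite sumr_const card_ord natz.
  apply: gtr0_sgz; apply: pos; first exact: basis_mem be (mem_tnth i e).
  by apply: free_not0 (mem_tnth i e); exact: basis_free be.
case: xgetP => [s _ [e [be _ ->]]|/(_ (\dim L)%:Z) [] /=]; first exact: pos1.
have [e be oe] := orthogonal_basis bB symB pos.
by exists e; split=> //; rewrite pos1.
Qed.

Lemma form_index_max B L : bilinear_form B -> (0 < \dim L)%N ->
  form_index B L = (\dim L)%:Z -> positive_on B L.
Proof.
move=> bB d0; rewrite /form_index.
(* The default value 0 is ruled out because \dim L is positive. *)
case: xgetP => [s _ [e [be oe ->]]|_ d]; last first.
  by move: d0; rewrite -ltz_nat -d ltxx.
move=> sum_eq.
have sgz1 (x : R) : sgz x <= 1 by case: sgzP.
(* There are \dim L signs, each at most 1, with sum \dim L; hence each equals 1. *)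
have Be i : 0 < B (tnth e i) (tnth e i).
  have : \sum_(i < \dim L) (1 - sgz (B (tnth e i) (tnth e i))) == 0.
    by rewrite big_split /= sumrN sum_eq sumr_const card_ord natz subrr.
  rewrite psumr_eq0 => [|j _]; last by rewrite subr_ge0.
  move=> /allP /(_ i); rewrite mem_index_enum => /(_ isT) /=.
  by rewrite subr_eq0; case: sgzP.
move=> u uL u0.
have uE := coord_basis be uL.
have BuuE : B u u = \sum_(i < \dim L) coord e i u ^+ 2 * B (tnth e i) (tnth e i).
  rewrite {1}uE bform_suml //; apply: eq_bigr => i _.
  rewrite bformZl // {2}uE bform_sumr // (bigD1 i) //= big1 => [|j ji].
    by rewrite addr0 bformZr // mulrA -(tnth_nth 0) -expr2.
  by rewrite bformZr // -!tnth_nth oe ?mulr0 // eq_sym.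
rewrite BuuE lt_def sumr_ge0 ?andbT => [|i _]; last first.
  by rewrite mulr_ge0 ?sqr_ge0 // ltW.
apply: contraNneq u0 => /eqP; rewrite psumr_eq0 => [/allP h|i _]; last first.
  by rewrite mulr_ge0 ?sqr_ge0 // ltW.
rewrite uE big1 // => i _; have := h i; rewrite mem_index_enum => /(_ isT) /=.
by rewrite mulf_eq0 (gt_eqF (Be i)) orbF sqrf_eq0 => /eqP ->; rewrite scale0r.
Qed.

End FormIndex.

(** * Limits of subspaces *)

Section OrthogonalProjectors.
Variables (R : realType) (N : nat).
Local Notation V := 'rV[R]_N.
Implicit Types (M : 'M[R]_N) (L E : {vspace V}).

(** For a symmetric idempotent the trace is the rank. Stated this way all conditions are closed, so
    limits keep the dimension. *)
Definition orthogonal_projector (d : nat) : set 'M[R]_N :=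
  [set M | [/\ M^T = M, M *m M = M & \tr M = d%:R]].

Lemma rV_dot_eq0 m (w : 'rV[R]_m) : w *m w^T = 0 -> w = 0.
Proof.
move=> /matrixP /(_ 0 0); rewrite !mxE => ww; apply/rowP => i; rewrite mxE.
apply/eqP; rewrite -sqrf_eq0 expr2; move/eqP: ww.
under eq_bigr do rewrite !mxE -expr2.
rewrite psumr_eq0 => [/allP /(_ i)|j _]; last exact: sqr_ge0.
by rewrite mem_index_enum => /(_ isT).
Qed.

Lemma ortho_projP L :
  orthogonal_projector (\dim L) (ortho_proj L) /\
  (forall u, (u \in L) = (u *m ortho_proj L == u)).
Proof.
rewrite /ortho_proj; set F : 'M[R]_(\dim L, N) := \matrix_(i < _) _.
have mulF c : c *m F = \sum_i c 0 i *: tnth (vbasis L) i.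
  by rewrite mulmx_sum_row; apply: eq_bigr => i _; rewrite rowK.
have memL u : reflect (exists c, u = c *m F) (u \in L).
  apply: (iffP idP) => [uL|[c ->]].
    exists (\row_i coord (vbasis L) i u); rewrite mulF [LHS](coord_vbasis uL).
    by apply: eq_bigr => i _; rewrite mxE (tnth_nth 0).
  rewrite mulF memv_suml // => i _; rewrite memvZ // vbasis_mem //.
  exact: mem_tnth.
(* If v kills the Gram matrix, then v F has zero square norm, so v F = 0, and v = 0 because the rows
   of F are free. *)
have G_unit : F *m F^T \in unitmx.
  rewrite -row_free_unit -kermx_eq0; apply/eqP/row_matrixP => i; rewrite row0.
  set v := row i _; have vG : v *m (F *m F^T) = 0.
    by rewrite -row_mul mulmx_ker row0.
  have : v *m F = 0.
    by apply: rV_dot_eq0; rewrite trmx_mul -mulmxA (mulmxA F) mulmxA vG mul0mx.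
  rewrite mulF => v0; apply/rowP => j; rewrite [RHS]mxE.
  have /freeP := basis_free (vbasisP L).
  move=> /(_ (v 0)); apply; rewrite -[RHS]v0.
  by apply: eq_bigr => k _; rewrite (tnth_nth 0).
split; first split.
- by rewrite !trmx_mul trmxK trmx_inv trmx_mul trmxK mulmxA.
- by rewrite !mulmxA -(mulmxA _ F) mulmxKV.
- by rewrite mxtrace_mulC mulmxA mulmxV // mxtrace1.
move=> u; apply/memL/eqP => [[c ->]|<-].
  by rewrite !mulmxA -(mulmxA c) mulmxK.
by exists (u *m (F^T *m invmx (F *m F^T))); rewrite mulmxA.
Qed.

Lemma mem_ortho_proj L v : v *m ortho_proj L \in L.
Proof.
have [[_ idem _] memL] := ortho_projP L.
by rewrite memL -mulmxA idem.
Qed.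

Lemma ortho_proj_inj : injective (@ortho_proj R N).
Proof.
move=> L E LE; apply/vspaceP => u.
by rewrite (ortho_projP L).2 (ortho_projP E).2 LE.
Qed.

(** Equal ranges give M M' = M and M' M = M'; transposing the first gives M' M = M. *)
Lemma projector_unique M M' : M^T = M -> M'^T = M' -> M *m M = M ->
  M' *m M' = M' -> (forall u : V, (u *m M == u) = (u *m M' == u)) -> M = M'.
Proof.
move=> sM sM' iM iM' eqr.
have MM' : M *m M' = M.
  apply/row_matrixP => i; rewrite row_mul; apply/eqP.
  by rewrite -eqr -row_mul iM.
have M'M : M' *m M = M'.
  apply/row_matrixP => i; rewrite row_mul; apply/eqP.
  by rewrite eqr -row_mul iM'.
by have := congr1 trmx MM'; rewrite trmx_mul sM sM' M'M.
Qed.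

Lemma projector_vspace d M : orthogonal_projector d M ->
  exists2 E, ortho_proj E = M & \dim E = d.
Proof.
move=> [sM iM tM]; pose E : {vspace V} := limg (linfun (mulmxr M)).
have EM : ortho_proj E = M.
  have [[sE iE _] memE] := ortho_projP E.
  apply: projector_unique => // u; rewrite -memE.
  apply/memv_imgP/eqP => [[w _ ->]|<-].
    by rewrite lfunE /= -mulmxA iM.
  by exists u; rewrite ?memvf // lfunE.
exists E => //; have [[_ _ tE] _] := ortho_projP E.
by apply/eqP; rewrite -(eqr_nat R) -tE EM tM.
Qed.

(** By symmetry and idempotence M k k is the sum of the squares of row k. It therefore bounds each
    of these squares, in particular its own, whence M k k is at most 1. *)
Lemma projector_entry_bound d M i j : orthogonal_projector d M -> `|M i j| <= 1.
Proof.
move=> [sM iM _].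
have sym k l : M k l = M l k by rewrite -{1}sM mxE.
have diag k : M k k = \sum_l M k l ^+ 2.
  rewrite -{1}iM mxE; apply: eq_bigr => l _.
  by rewrite (sym l k) expr2.
have le_diag k l : M k l ^+ 2 <= M k k.
  by rewrite diag (bigD1 l) //= lerDl sumr_ge0 // => m _; exact: sqr_ge0.
have diag1 k : M k k <= 1.
  have := le_diag k k; rewrite expr2; have [->|Mk] := eqVneq (M k k) 0 => //.
  have Mk0 : 0 < M k k by rewrite lt_neqAle eq_sym Mk diag sumr_ge0 // => l _; exact: sqr_ge0.
  by rewrite -ler_pdivlMr // divff.
by rewrite -(@expr_le1 _ 2) // -normrX ger0_norm ?sqr_ge0 // (le_trans (le_diag i j)).
Qed.


Lemma cvg_mx_coord (T : Type) (F : set_system T) {FF : Filter F} m p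
    (f : T -> 'M[R]_(m, p)) (M : 'M[R]_(m, p)) :
  (forall i j, f t i j @[t --> F] --> M i j) -> f @ F --> M.
Proof.
move=> fM A [P PM sPA]; rewrite /fmap /=.
have FP : F [set t | forall i j, P i j (f t i j)].
  apply: filter_forall => i; apply: filter_forall => j.
  exact: (fM i j _ (PM i j)).
by apply: (@filterS _ F FF _ (f @^-1` A) _ FP) => t Pt; exact: (sPA _ Pt).
Qed.

Lemma continuous_mx (T : topologicalType) m p (f : T -> 'M[R]_(m, p)) :
  (forall i j, continuous (fun t => f t i j)) -> continuous f.
Proof. by move=> cf t; apply: cvg_mx_coord => i j; exact: cf. Qed.

(** A box of matrices is the continuous image under [vec_mx] of a product of segments. *)
Lemma box_compact m p (c : R) :
  compact [set M : 'M[R]_(m, p) | forall i j, `|M i j| <= c].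
Proof.
have cbox : compact [set v : 'rV[R]_(m * p) | forall i, `[(- c), c]%classic (v ord0 i)].
  by apply: (@rV_compact _ _ (fun=> `[(- c), c]%classic)) => _; exact: segment_compact.
have cvec : continuous (@vec_mx R m p).
  apply: continuous_mx => i j; under eq_fun do rewrite mxE.
  exact: coord_continuous.
have := continuous_compact (continuous_subspaceT cvec) cbox.
congr compact; apply/seteqP; split=> M /=.
  by move=> [v vc <-] i j; rewrite mxE ler_norml; have := vc (mxvec_index i j); rewrite /= in_itv.
move=> Mc; exists (mxvec M); last by rewrite mxvecK.
by case/mxvec_indexP => i j; rewrite mxvecE /= in_itv /= -ler_norml.
Qed.

Lemma trace_continuous (T : topologicalType) m (f : T -> 'M[R]_m) :
  (forall i j, continuous (fun t => f t i j)) -> continuous (fun t => \tr (f t)).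
Proof.
move=> cf t; apply: cvg_big => [|i _]; first exact: add_continuous.
exact: cf.
Qed.

Lemma orthogonal_projector_closed d : closed (@orthogonal_projector d).
Proof.
have cid i j : continuous (fun M : 'M[R]_N => M i j) by exact: coord_continuous.
have -> : orthogonal_projector d =
  (\bigcap_(i in [set: 'I_N]) \bigcap_(j in [set: 'I_N]) ([set M : 'M[R]_N | M j i - M i j = 0] `&`
     [set M : 'M[R]_N | (M *m M) i j - M i j = 0])) `&` [set M | \tr M = d%:R].
  apply/seteqP; split=> M /=.
    move=> [/matrixP sM iM tM]; split=> // i _ j _; split=> /=.
      by rewrite -(sM i j) mxE subrr.
    by rewrite iM subrr.
  move=> [h tM]; split=> //; apply/matrixP => i j; have [] := h i I j I => /=.
    by move=> /subr0_eq + _; rewrite mxE.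
  by move=> _ /subr0_eq.
apply: closedI.
  apply: closed_bigI => i _; apply: closed_bigI => j _; apply: closedI.
    have cf : continuous (fun M : 'M[R]_N => M j i - M i j).
      by apply: continuous_sub.
    exact: (closed_comp (fun u _ => cf u) (@closed_eq R 0)).
  have cf : continuous (fun M : 'M[R]_N => (M *m M) i j - M i j).
    by apply: continuous_sub => //; apply: mulmx_coord_continuous.
  exact: (closed_comp (fun u _ => cf u) (@closed_eq R 0)).
have cf : continuous (fun M : 'M[R]_N => \tr M).
  exact: trace_continuous.
exact: (closed_comp (fun u _ => cf u) (@closed_eq R _)).
Qed.

Lemma orthogonal_projector_compact d : compact (@orthogonal_projector d).
Proof.
apply: (subclosed_compact (@orthogonal_projector_closed d) (@box_compact N N 1)).
by move=> M pM i j; exact: projector_entry_bound pM.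
Qed.

Section Limits.
Variables (T : Type) (F : set_system T) (d : nat) (L : T -> {vspace V}).
Variable Q : nat -> V -> V -> R.
Context {FF : ProperFilter F}.
Hypothesis bQ : forall j, bilinear_form (Q j).
Hypothesis dimL : forall t, \dim (L t) = d.
Hypothesis nonnegL :
  forall j, \forall t \near F, forall u, u \in L t -> 0 <= Q j u u.

Let image_projector (G : set_system T) : Filter G ->
  ((fun t => ortho_proj (L t)) @ G) (orthogonal_projector d).
Proof.
move=> FG; apply: (@filterE _ G) => t.
by rewrite -(dimL t); exact: (ortho_projP _).1.
Qed.

(** Being a projector of trace d is a closed condition on M, and so is nonnegativity of Q j at u M
    for fixed u; both pass to cluster points. *)
Lemma cluster_subspace p : cluster ((fun t => ortho_proj (L t)) @ F) p ->
  exists E, [/\ ortho_proj E = p, \dim E = d &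
    forall j u, u \in E -> 0 <= Q j u u].
Proof.
rewrite clusterE => clp.
have [|E Ep dE] := @projector_vspace d p.
  by apply: orthogonal_projector_closed; apply: clp; exact: image_projector.
exists E; split=> // j u; rewrite (ortho_projP E).2 Ep => /eqP <-.
have cl : closed [set M : 'M[R]_N | 0 <= Q j (u *m M) (u *m M)].
  have cM : continuous (fun M : 'M[R]_N => u *m M).
    apply: continuous_mx => i k.
    apply: mulmx_coord_continuous => // k' l; first exact: cst_continuous.
    exact: coord_continuous.
  have cf := form_continuous (bQ j) cM cM.
  exact: (closed_comp (fun u _ => cf u) (@closed_ge R 0)).
apply: cl; apply: clp.
by apply: filterS (nonnegL j) => t Lt; apply: Lt; exact: mem_ortho_proj.
Qed.

Lemma exists_limit_subspace :
  exists2 E, \dim E = d & forall j u, u \in E -> 0 <= Q j u u.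
Proof.
have [|p [_ clp]] := @orthogonal_projector_compact d ((fun t => ortho_proj (L t)) @ F) _.
  exact: image_projector.
by have [E [_ dE QE]] := cluster_subspace clp; exists E.
Qed.

(** Compactness argument: if the projectors did not eventually enter an open W around the limit, F
    restricted to those outside W would still have a cluster point. By uniqueness this point is the
    projector of E0, which lies in W. *)
Lemma cvg_limit_subspace E0 :
  (forall E, \dim E = d -> (forall j u, u \in E -> 0 <= Q j u u) -> E = E0) ->
  (fun t => ortho_proj (L t)) @ F --> ortho_proj E0.
Proof.
move=> uniqE U; rewrite nbhsE => -[W [oW WE0] sWU]; apply: filterS sWU _.
apply: contrapT => nFW.
pose G := within (fun t => ~ W (ortho_proj (L t))) F.
have PG : ProperFilter G.
  split; last exact: within_filter.
  rewrite /G /within /= => G0; apply: nFW; rewrite /= nbhs_simpl.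
  by apply: (@filterS _ F _ _ _ _ G0) => t nW; apply: contrapT => /nW.
have [|p [_ clp]] := @orthogonal_projector_compact d ((fun t => ortho_proj (L t)) @ G) _.
  exact: image_projector.
have [E [Ep dE QE]] : exists E, [/\ ortho_proj E = p, \dim E = d &
    forall j u, u \in E -> 0 <= Q j u u].
  apply: cluster_subspace; apply: cvg_cluster clp.
  by apply: cvg_app; exact: cvg_within.
have Wp : nbhs p W by rewrite -Ep (uniqE E dE QE); exact: open_nbhs_nbhs.
have GnW : ((fun t => ortho_proj (L t)) @ G) (~` W) by exact: withinT.
by have [q []] := clp _ _ GnW Wp.
Qed.
End Limits.

End OrthogonalProjectors.

(** * The forms of a pair of transverse Lagrangians *)

Section SymplecticForms.
Variables (R : realType) (n : nat).
Local Notation V := 'rV[R]_(n + n).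
Variable omega : {skew_symmetric V}.
Implicit Types (P Q L : {vspace V}) (u v w : V).

Lemma omega_bilinear : bilinear_form omega.
Proof.
split=> [v a u w|u a v w] /=.
  by rewrite linearPl.
by rewrite linearPr.
Qed.

Lemma omegaC u v : omega u v = - omega v u.
Proof. by rewrite hermC /= expr1 mulN1r. Qed.

Definition positive P L Q : Prop := positive_on (BPQ omega P Q) L.

Lemma BPQ_bilinear P Q : bilinear_form (BPQ omega P Q).
Proof.
split=> [v a u w|u a v w]; rewrite /BPQ.
  by rewrite (bformPl omega_bilinear).
have -> : sigma P Q (a *: v + w) = a *: sigma P Q v + sigma P Q w.
  by rewrite /sigma !linearP /= scalerDr addrACA.
by rewrite (bformPr omega_bilinear).
Qed.

Lemma BPQN P Q u v : BPQ omega Q P u v = - BPQ omega P Q u v.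
Proof.
rewrite /BPQ -(bformNr omega_bilinear) /sigma opprD opprK addrC.
by [].
Qed.

Section Transverse.
Variables P Q : {vspace V}.
Hypotheses (lagP : lagrangian omega P) (lagQ : lagrangian omega Q).
Hypothesis PQ0 : transverse P Q.

Lemma lagrangian_sum : (P + Q)%VS = fullv.
Proof.
apply/eqP; rewrite eqEdim subvf dimvf dimv_disjoint_sum //.
by rewrite lagP.1 lagQ.1 /dim /= mul1n.
Qed.

Lemma lagrangian_decomp u : daddv_pi P Q u + daddv_pi Q P u = u.
Proof. by apply: daddv_pi_add => //; rewrite lagrangian_sum memvf. Qed.

Lemma lagrangian_decompP u v w : v \in P -> w \in Q -> u = v + w ->
  daddv_pi P Q u = v /\ daddv_pi Q P u = w.
Proof.
have QP0 : (Q :&: P)%VS = 0%VS by rewrite capvC.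
move=> vP wQ ->; rewrite !linearD /=.
rewrite (daddv_pi_id PQ0 vP) (daddv_pi_id QP0 wQ).
have -> : daddv_pi P Q w = 0.
  apply: (addIr w); rewrite add0r -{3}(lagrangian_decomp w).
  by rewrite (daddv_pi_id QP0 wQ).
have -> : daddv_pi Q P v = 0.
  apply: (addrI v); rewrite addr0 -{3}(lagrangian_decomp v).
  by rewrite (daddv_pi_id PQ0 vP).
by rewrite addr0 add0r.
Qed.

Lemma BPQ_decomp v v' w w' : v \in P -> v' \in P -> w \in Q -> w' \in Q ->
  BPQ omega P Q (v + w) (v' + w') = omega v w' + omega v' w.
Proof.
move=> vP v'P wQ w'Q; rewrite /BPQ /sigma.
have [-> ->] := lagrangian_decompP v'P w'Q erefl.
have bo := omega_bilinear.
rewrite (bformDl bo) !(bformDr bo) !(bformNr bo) (lagP.2 _ _ vP v'P).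
by rewrite (lagQ.2 _ _ wQ w'Q) oppr0 add0r addr0 (omegaC w) opprK.
Qed.

Lemma BPQE u : BPQ omega P Q u u = omega (daddv_pi P Q u) (daddv_pi Q P u) *+ 2.
Proof.
by rewrite -{1 2}[u]lagrangian_decomp BPQ_decomp ?memv_pi.
Qed.

Lemma BPQC u v : BPQ omega P Q u v = BPQ omega P Q v u.
Proof.
rewrite -[u]lagrangian_decomp -[v]lagrangian_decomp.
by rewrite !BPQ_decomp ?memv_pi // addrC.
Qed.

Lemma BPQ_right0 u : u \in Q -> BPQ omega P Q u u = 0.
Proof.
move=> uQ; rewrite -[u]add0r BPQ_decomp ?mem0v //.
by rewrite (bform0l omega_bilinear) addr0.
Qed.

End Transverse.

(** The map f carries the splitting along P and Q to the one along P' and Q', so it intertwines the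
    two maps [sigma]. *)
Lemma BPQ_symplectic P Q P' Q' (f : 'End(V)) u v : symplectic omega f ->
  lagrangian omega P -> lagrangian omega Q -> transverse P Q ->
  lagrangian omega P' -> lagrangian omega Q' -> transverse P' Q' ->
  (f @: P)%VS = P' -> (f @: Q)%VS = Q' ->
  BPQ omega P' Q' (f u) (f v) = BPQ omega P Q u v.
Proof.
move=> sf lP lQ PQ lP' lQ' PQ' fP fQ; rewrite /BPQ -[RHS]sf; congr (omega _ _).
have fvP : f (daddv_pi P Q v) \in P' by rewrite -fP memv_img ?memv_pi.
have fvQ : f (daddv_pi Q P v) \in Q' by rewrite -fQ memv_img ?memv_pi.
have fvE : f v = f (daddv_pi P Q v) + f (daddv_pi Q P v).
  by rewrite -linearD lagrangian_decomp.
rewrite /sigma; have [-> ->] := lagrangian_decompP lP' lQ' PQ' fvP fvQ fvE.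
by rewrite linearD linearN.
Qed.


Lemma transverseC P Q : transverse P Q -> transverse Q P.
Proof. by rewrite /transverse capvC. Qed.

(* If pi_Q u = p' + q' along P + Q', then u = (pi_P u + p') + q' is the
   splitting of u along P + Q'. *)
Lemma BPQ_sub_right P Q Q' u :
  lagrangian omega P -> lagrangian omega Q -> lagrangian omega Q' ->
  transverse P Q -> transverse P Q' ->
  BPQ omega P Q u u - BPQ omega P Q' u u
    = BPQ omega Q' P (daddv_pi Q P u) (daddv_pi Q P u).
Proof.
move=> lP lQ lQ' PQ PQ'; set w := daddv_pi Q P u; set v := daddv_pi P Q u.
have uE : u = v + w by rewrite lagrangian_decomp.
rewrite [in RHS]BPQN // [in RHS]BPQE //.
set p' := daddv_pi P Q' w; set q' := daddv_pi Q' P w.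
have wE : w = p' + q' by rewrite lagrangian_decomp.
have p'P : p' \in P by exact: memv_pi.
have q'Q : q' \in Q' by exact: memv_pi.
have vP : v \in P by exact: memv_pi.
have bo := omega_bilinear.
have -> : BPQ omega P Q' u u = omega (v + p') q' *+ 2.
  rewrite (_ : u = (v + p') + q'); last by rewrite -addrA -wE.
  by rewrite BPQ_decomp ?memvD.
have -> : BPQ omega P Q u u = omega v (p' + q') *+ 2 by rewrite -wE BPQE.
rewrite (bformDl bo) (bformDr bo) (lP.2 _ _ vP p'P) add0r.
by rewrite mulrnDl opprD addNKr.
Qed.

(* For P < P' < Q' < Q in cyclic order, shrink the interval (P, Q) first to
   (P, Q') and then to (P', Q'): each step subtracts a semidefinite form, of
   radical P and Q' respectively. *)
Lemma BPQ_strict_mono P P' Q Q' u :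
  lagrangian omega P -> lagrangian omega P' ->
  lagrangian omega Q -> lagrangian omega Q' ->
  transverse P Q -> transverse P Q' -> transverse P' Q' ->
  positive Q' Q P -> positive P P' Q' -> u != 0 ->
  BPQ omega P' Q' u u < BPQ omega P Q u u.
Proof.
move=> lP lP' lQ lQ' PQ PQ' P'Q' posQ posP' u0.
have sub1 := BPQ_sub_right u lP lQ lQ' PQ PQ'.
have := BPQ_sub_right u lQ' lP' lP (transverseC P'Q') (transverseC PQ').
rewrite 2!(BPQN _ Q') opprK addrC => sub2.
have nonneg A L B w : positive A L B -> w \in L -> 0 <= BPQ omega A B w w.
  move=> pos wL; have [->|w0] := eqVneq w 0; last by apply: ltW; exact: pos.
  by rewrite (bform0l (BPQ_bilinear _ _)).
have ge1 := nonneg _ _ _ _ posQ (memv_pi Q P u).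
have ge2 := nonneg _ _ _ _ posP' (memv_pi P' Q' u).
have [w0|w_neq0] := eqVneq (daddv_pi Q P u) 0; last first.
  have := posQ _ (memv_pi Q P u) w_neq0; lra.
have [w'0|w'_neq0] := eqVneq (daddv_pi P' Q' u) 0; last first.
  have := posP' _ (memv_pi P' Q' u) w'_neq0; lra.
(* Both semidefinite terms vanish, so u lies in P and in Q', which are transverse. *)
case/eqP: u0; apply/eqP; rewrite -memv0 -PQ' memv_cap; apply/andP; split.
  by rewrite -(lagrangian_decomp lP lQ PQ u) w0 addr0 memv_pi.
by rewrite -(lagrangian_decomp lP' lQ' P'Q' u) w'0 add0r memv_pi.
Qed.

Lemma lag_cyc_positive P L Q : (0 < n)%N -> lag_cyc omega P L Q -> positive P L Q.
Proof.
move=> n0 [_ [dL _] _ _ ind]; apply: form_index_max; rewrite ?dL //.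
exact: BPQ_bilinear.
Qed.

Lemma positive_lag_cyc P L Q : lagrangian omega P -> lagrangian omega L ->
  lagrangian omega Q -> transverse P Q -> positive P L Q -> lag_cyc omega P L Q.
Proof.
move=> lP lL lQ PQ pos; split=> //; rewrite /maslov.
rewrite form_index_positive ?lL.1 //; first exact: BPQ_bilinear.
exact: BPQC.
Qed.

(** Arithmetic of [positive_near], with m the square norm of u: x0 is the leading term, x1 and x2
    the cross terms, x3 the quadratic one, and t < 1 absorbs t^2 into t. *)
Lemma perturbation_gt0 (t e c1 c2 c3 m x0 x1 x2 x3 : R) :
  0 < t -> t < 1 -> 0 <= c3 -> t * (c1 + c2 + c3 + 1) < e -> 0 < m ->
  e * m <= x0 -> - (c1 * m) <= x1 -> - (c2 * m) <= x2 -> - (c3 * m) <= x3 ->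
  0 < x0 + t * x1 + (t * x2 + t * (t * x3)).
Proof.
move=> t0 t1 c30 te m0 b0 b1 b2 b3.
have tb1 := ler_wpM2l (ltW t0) b1; have tb2 := ler_wpM2l (ltW t0) b2.
have tb3 := ler_wpM2l (ltW t0) (ler_wpM2l (ltW t0) b3).
have ttn : t * (t * (c3 * m)) <= t * (c3 * m).
  by rewrite (ler_wpM2l (ltW t0)) // ler_piMl ?(ltW t1) // mulr_ge0 // ltW.
have ten : t * (c1 + c2 + c3 + 1) * m < e * m by rewrite ltr_pM2r.
have tm : 0 < t * m by rewrite mulr_gt0.
lra.
Qed.

Lemma positive_near (C : V -> V -> R) (M : {vspace V}) (f h : 'End(V)) :
  bilinear_form C -> (forall u, u \in M -> u != 0 -> 0 < C (f u) (f u)) ->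
  \forall t \near 0^'+, forall u, u \in M -> u != 0 ->
    0 < C (f u + t *: h u) (f u + t *: h u).
Proof.
move=> bC pos.
have bilin_comp (f1 f2 : 'End(V)) : bilinear_form (fun u v => C (f1 u) (f2 v)).
  split=> [v a u w|u a v w] /=; rewrite linearP.
    by rewrite (bformPl bC).
  by rewrite (bformPr bC).
have [e e0 low] := positive_on_lower_bound (bilin_comp f f) pos.
have [c1 c10 bound1] := form_bound (bilin_comp f h).
have [c2 c20 bound2] := form_bound (bilin_comp h f).
have [c3 c30 bound3] := form_bound (bilin_comp h h).
(* Adding 1 keeps the denominator positive when all three constants vanish. *)
have d0 : 0 < e / (c1 + c2 + c3 + 1) by rewrite divr_gt0 //; lra.
near=> t => u uM u0.
have t0 : 0 < t by near: t; exact: nbhs_right_gt.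
have t1 : t < 1 by near: t; exact: nbhs_right_lt.
have te : t * (c1 + c2 + c3 + 1) < e.
  rewrite -ltr_pdivlMr; last lra.
  by near: t; exact: nbhs_right_lt.
rewrite (bformDl bC) !(bformDr bC) !(bformZl bC) !(bformZr bC).
have nu : 0 < `|u| ^+ 2 by rewrite exprn_gt0 // normr_gt0.
have := low u uM; have := bound1 u u; have := bound2 u u; have := bound3 u u.
rewrite -expr2 !ler_norml => /andP[b3 _] /andP[b2 _] /andP[b1 _] b0.
exact: perturbation_gt0 b0 b1 b2 b3.
Unshelve. all: by end_near. Qed.

(** The map pi_P + t pi_Q multiplies both omega and B_PQ by t. It therefore moves M to Lagrangians
    that stay in the interval and approach P as t tends to 0, where the forms C i become
    positive. *)
Lemma exists_lagrangian_near (I : finType) (C : I -> V -> V -> R) P M Q :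
  lagrangian omega P -> lagrangian omega M -> lagrangian omega Q ->
  transverse P Q -> positive P M Q ->
  (forall i, bilinear_form (C i)) -> (forall i, positive_on (C i) P) ->
  exists L, [/\ lagrangian omega L, positive P L Q &
    forall i, positive_on (C i) L].
Proof.
move=> lP lM lQ PQ posM bC posC.
pose f := daddv_pi P Q; pose h := daddv_pi Q P.
have posf i u : u \in M -> u != 0 -> 0 < C i (f u) (f u).
  move=> uM u0; apply: posC; first exact: memv_pi.
  (* If the P-component of u vanishes, u lies in Q, where B_PQ is zero. *)
  apply: contraTneq (posM u uM u0) => fu0; rewrite -leNgt.
  rewrite BPQ_right0 // -(lagrangian_decomp lP lQ PQ u) -/(f u) fu0 add0r.
  exact: memv_pi.
have near_pos : \forall t \near 0^'+, forall i u, u \in M -> u != 0 ->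
    0 < C i (f u + t *: h u) (f u + t *: h u).
  by apply: filter_forall => i; apply: positive_near => //; exact: posf.
have [t [t0 tpos]] : exists t : R, 0 < t /\ forall i u, u \in M -> u != 0 ->
    0 < C i (f u + t *: h u) (f u + t *: h u).
  by apply: (@filter_ex _ 0^'+); apply: filterI near_pos; exact: nbhs_right_gt.
have bo := omega_bilinear.
pose phi : 'End(V) := (f + t *: h)%VF.
have phiE u : phi u = f u + t *: h u by rewrite !lfunE /= !lfunE.
have BphiE u : BPQ omega P Q (phi u) (phi u) = t * BPQ omega P Q u u.
  rewrite phiE BPQ_decomp ?memvZ ?memv_pi // BPQE // (bformZr bo) -mulr2n.
  by rewrite mulrnAr.
have phi_neq0 u : u \in M -> u != 0 -> phi u != 0.
  move=> uM u0; apply: contraTneq (posM u uM u0) => phi0.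
  rewrite -leNgt -(pmulr_rle0 _ t0) -BphiE phi0.
  by rewrite (bform0l (BPQ_bilinear P Q)).
exists (phi @: M)%VS; split; first split.
- apply: etrans lM.1; apply: limg_dim_eq; apply/eqP; rewrite -subv0.
  apply/subvP => u; rewrite memv_cap memv_ker memv0 => /andP[uM].
  by apply: contraTT; exact: phi_neq0.
- move=> _ _ /memv_imgP[u uM ->] /memv_imgP[v vM ->]; rewrite !phiE.
  have fuv : omega (f u) (f v) = 0 by apply: lP.2; exact: memv_pi.
  have huv : omega (h u) (h v) = 0 by apply: lQ.2; exact: memv_pi.
  have uE : u = f u + h u by rewrite lagrangian_decomp.
  have vE : v = f v + h v by rewrite lagrangian_decomp.
  have := lM.2 _ _ uM vM; rewrite {1}uE {1}vE.
  rewrite !(bformDl bo) !(bformDr bo) !(bformZl bo) !(bformZr bo) fuv huv.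
  by rewrite !add0r !addr0 !mulr0 addr0 -mulrDr => ->; rewrite mulr0.
- move=> _ /memv_imgP[u uM ->] phi0; rewrite BphiE pmulr_rgt0 //.
  by apply: posM => //; apply: contraNneq phi0 => ->; rewrite linear0.
move=> i _ /memv_imgP[u uM ->] phi0; rewrite phiE.
by apply: tpos => //; apply: contraNneq phi0 => ->; rewrite linear0.
Qed.

End SymplecticForms.

(** * Intervals of the circle *)

Section CircleIntervals.
Variable R : realType.
Implicit Types x y z a b : circle R.

(** Transitivity is a boolean implication here, so that [ccw_interlaced] can evaluate it by
    cases. *)
Lemma circle_lt_trans x y z :
  circle_lt x y && circle_lt y z ==> circle_lt x z.
Proof.
apply/implyP; case: x y z => [x|] [y|] [z|] //= /andP[] //; first exact: lt_trans.
Qed.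

Lemma circle_lt_asym x y : x <> y -> circle_lt y x = ~~ circle_lt x y.
Proof.
case: x y => [x|] [y|] //= xy; rewrite -leNgt lt_neqAle andbC.
by case: eqVneq xy => [->|]; rewrite ?andbT.
Qed.

Lemma ccw_rotate x y z : ccw x y z -> ccw y z x.
Proof. by rewrite /ccw => /or3P[] -> ; rewrite ?orbT. Qed.

(** The hypotheses leave only the cyclic order a, b, a', b'. Once transitivity is available on all
    ordered triples, what remains is a truth table in six comparisons. *)
Lemma ccw_interlaced a b a' b' : a <> b -> a' <> b' -> a <> a' -> a <> b' ->
  b <> a' -> b <> b' ->
  ~~ ccw a a' b -> ~~ ccw a b' b -> ~~ ccw a' a b' -> ~~ ccw a' b b' ->
  [/\ ccw b b' a, ccw b a' a & ccw b a' b'].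
Proof.
move=> ab a'b' aa' ab' ba' bb'.
move: (circle_lt_trans a b a') (circle_lt_trans a' b a).
move: (circle_lt_trans a a' b) (circle_lt_trans b a' a).
move: (circle_lt_trans a b b') (circle_lt_trans b' b a).
move: (circle_lt_trans a b' b) (circle_lt_trans b b' a).
move: (circle_lt_trans a a' b') (circle_lt_trans b' a' a).
move: (circle_lt_trans a b' a') (circle_lt_trans a' b' a).
move: (circle_lt_trans b a' b') (circle_lt_trans b' a' b).
move: (circle_lt_trans b b' a') (circle_lt_trans a' b' b).
move: (circle_lt_trans b a a') (circle_lt_trans a' a b).
move: (circle_lt_trans b a b') (circle_lt_trans b' a b).
move: (circle_lt_trans a' a b') (circle_lt_trans b' a a').
move: (circle_lt_trans a' b b') (circle_lt_trans b' b a').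
rewrite /ccw (circle_lt_asym ab) (circle_lt_asym a'b') (circle_lt_asym aa').
rewrite (circle_lt_asym ab') (circle_lt_asym ba') (circle_lt_asym bb').
by case: (circle_lt a b); case: (circle_lt a' b'); case: (circle_lt a a');
  case: (circle_lt a b'); case: (circle_lt b a'); case: (circle_lt b b').
Qed.

Lemma nbhs_circle_Some (t : R) (U : set (circle R)) : nbhs (Some t : circle R) U ->
  exists2 e, 0 < e & forall s, `|t - s| < e -> U (Some s).
Proof. by move=> /nbhs_ballP[e e0 eU]; exists e => // s ts; exact: eU. Qed.

Lemma nbhs_circle_None (U : set (circle R)) : nbhs (None : circle R) U ->
  exists M, forall s, M < `|s| -> U (Some s).
Proof.
move=> [C [/compact_bounded[M [_ CM]] _] CU]; exists (M + 1) => s Ms.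
apply: CU; left; exists s => // /(CM (M + 1)) /=.
by rewrite ltrDl ltr01 => /(_ isT); rewrite leNgt Ms.
Qed.

(** Points just after a are exhibited inside the interval: a small step to the right of a finite a,
    a very negative real when a is infinity. *)
Lemma closure_interval_left a b : a <> b -> closure (circle_interval a b) a.
Proof.
case: a b => [s|] [t|] //= st U.
- move=> nU; have [e e0 eU] := nbhs_circle_Some nU.
  have [lst|lts|est] := ltgtP s t; last by rewrite est in st.
    exists (Some (s + Num.min e (t - s) / 2)).
    have m0 : 0 < Num.min e (t - s) by rewrite lt_min e0 subr_gt0.
    have [me mt] : Num.min e (t - s) <= e /\ Num.min e (t - s) <= t - s.
      by rewrite !ge_min !lexx orbT.
    split; first by apply/or3P/Or31; apply/andP; split => /=; lra.
    by apply: eU; rewrite opprD addNKr normrN gtr0_norm; lra.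
  (* For t < s the interval passes through infinity, so b does not limit the step. *)
  exists (Some (s + e / 2)).
  split; first by apply/or3P/Or33; apply/andP; split => /=; lra.
  by apply: eU; rewrite opprD addNKr normrN gtr0_norm; lra.
- move=> nU; have [e e0 eU] := nbhs_circle_Some nU; exists (Some (s + e / 2)).
  split; first by apply/or3P/Or31; apply/andP; split => //=; lra.
  by apply: eU; rewrite opprD addNKr normrN gtr0_norm; lra.
- move=> nU; have [M MU] := nbhs_circle_None nU; exists (Some (- (`|M| + `|t| + 1))).
  have [[[tn Mn] t0] M0] := (ler_norm (- t), ler_norm M, normr_ge0 t, normr_ge0 M).
  rewrite normrN in tn.
  split; first by apply/or3P/Or32; apply/andP; split => //=; lra.
  by apply: MU; rewrite normrN gtr0_norm; lra.
Qed.

Lemma closure_interval_right a b : a <> b -> closure (circle_interval a b) b.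
Proof.
case: a b => [s|] [t|] //= st U.
- move=> nU; have [e e0 eU] := nbhs_circle_Some nU.
  have [lst|lts|est] := ltgtP s t; last by rewrite est in st.
    exists (Some (t - Num.min e (t - s) / 2)).
    have m0 : 0 < Num.min e (t - s) by rewrite lt_min e0 subr_gt0.
    have [me mt] : Num.min e (t - s) <= e /\ Num.min e (t - s) <= t - s.
      by rewrite !ge_min !lexx orbT.
    split; first by apply/or3P/Or31; apply/andP; split => /=; lra.
    by apply: eU; rewrite subKr gtr0_norm; lra.
  exists (Some (t - e / 2)).
  split; first by apply/or3P/Or32; apply/andP; split => /=; lra.
  by apply: eU; rewrite subKr gtr0_norm; lra.
- move=> nU; have [M MU] := nbhs_circle_None nU; exists (Some (`|M| + `|s| + 1)).
  have [[[sn Mn] s0] M0] := (ler_norm s, ler_norm M, normr_ge0 s, normr_ge0 M).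
  split; first by apply/or3P/Or31; apply/andP; split => //=; lra.
  by apply: MU; rewrite gtr0_norm; lra.
- move=> nU; have [e e0 eU] := nbhs_circle_Some nU; exists (Some (t - e / 2)).
  split; first by apply/or3P/Or32; apply/andP; split => //=; lra.
  by apply: eU; rewrite subKr gtr0_norm; lra.
Qed.

(** Endpoints belong to the closures, so disjointness of the closures separates the endpoints of one
    interval from those of the other and keeps them out of the other interval. *)
Lemma ccw_disjoint_intervals a b a' b' : a <> b -> a' <> b' ->
  closure (circle_interval a b) `&` closure (circle_interval a' b') = set0 ->
  [/\ ccw b b' a, ccw b a' a & ccw b a' b'].
Proof.
move=> ab a'b' dis.
have sep x : closure (circle_interval a b) x ->
    ~ closure (circle_interval a' b') x.
  by move=> Ix I'x; have : set0 x by rewrite -dis.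
have [Ia Ib] := (closure_interval_left ab, closure_interval_right ab).
have [Ia' Ib'] := (closure_interval_left a'b', closure_interval_right a'b').
apply: ccw_interlaced => //.
- by move=> e; apply: sep Ia _; rewrite e.
- by move=> e; apply: sep Ia _; rewrite e.
- by move=> e; apply: sep Ib _; rewrite e.
- by move=> e; apply: sep Ib _; rewrite e.
- by apply/negP => h; exact: (sep a' (@subset_closure _ (circle_interval a b) a' h) Ia').
- by apply/negP => h; exact: (sep b' (@subset_closure _ (circle_interval a b) b' h) Ib').
- by apply/negP => h; exact: (sep a Ia (@subset_closure _ (circle_interval a' b') a h)).
- by apply/negP => h; exact: (sep b Ib (@subset_closure _ (circle_interval a' b') b h)).
Qed.

End CircleIntervals.

(** * Nested intervals along a reduced word *)

Section SchottkyDynamics.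
Variables (R : realType) (n : nat).
Local Notation V := 'rV[R]_(n + n).
Variables (omega : {skew_symmetric V}) (g : nat) (A : 'I_g -> PSL2 R).
Variables (a b : letter g -> circle R) (xi0 : circle R -> {vspace V}).
Variable rho : PSL2 R -> 'End(V).
Hypothesis omega_symplectic : is_psymplectic omega.
Hypothesis n_gt0 : (0 < n)%N.
Hypothesis schottky : generalized_schottky omega A a b xi0 rho.
Implicit Types (l m : letter g) (u v : V) (x : nat -> letter g).

Local Notation gen_form l := (BPQ omega (xi0 (a l)) (xi0 (b l))).
Local Notation gen l := (rho (letter_val A l)).

Lemma inv_letterK : involutive (@inv_letter g).
Proof. by case=> j c; rewrite /inv_letter /= negbK. Qed.

Lemma inv_letter_neq l : inv_letter l != l.
Proof. by case: l => j c; rewrite /inv_letter xpair_eqE /= eqxx; case: c. Qed.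

Lemma lagrangian_a l : lagrangian omega (xi0 (a l)).
Proof. by apply: (schottky_lagrangian schottky); left; exists l. Qed.

Lemma lagrangian_b l : lagrangian omega (xi0 (b l)).
Proof. by apply: (schottky_lagrangian schottky); right; exists l. Qed.

Let end_a l : endpoints a b (a l). Proof. by left; exists l. Qed.
Let end_b l : endpoints a b (b l). Proof. by right; exists l. Qed.

(** The cyclic order a_l, b_l, a_m, b_m transported by [xi0]. The first triple places [xi0 (b m)] in
    the interval opposite to that of l; the other two nest the interval of m in that opposite. *)
Lemma lag_cyc_endpoints l m : l != m ->
  [/\ lag_cyc omega (xi0 (b l)) (xi0 (b m)) (xi0 (a l)),
      lag_cyc omega (xi0 (b m)) (xi0 (a l)) (xi0 (b l)) &
      lag_cyc omega (xi0 (b l)) (xi0 (a m)) (xi0 (b m))].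
Proof.
move=> lm; have inc := schottky_increasing schottky.
have [c1 _ c3] := ccw_disjoint_intervals (schottky_proper schottky (l := l))
  (schottky_proper schottky (l := m)) (schottky_disjoint schottky lm).
by split; apply: inc => //; exact: ccw_rotate.
Qed.

(** Transversality comes with [lag_cyc], which requires a third endpoint; the inverse letter
    supplies one. *)
Lemma transverse_ba l : transverse (xi0 (b l)) (xi0 (a l)).
Proof.
have ll : l != inv_letter l by rewrite eq_sym inv_letter_neq.
by have [[]] := lag_cyc_endpoints ll.
Qed.

Lemma gen_form_bilinear l : bilinear_form (gen_form l).
Proof. exact: BPQ_bilinear. Qed.

(** The interval of m is nested in the opposite of that of l, whose form is minus that of l;
    monotonicity of the forms concludes. *)
Lemma gen_form_add_lt0 l m u : l != m -> u != 0 ->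
  gen_form l u u + gen_form m u u < 0.
Proof.
move=> lm u0; have [_ c2 c3] := lag_cyc_endpoints lm.
have := BPQ_strict_mono (lagrangian_b l) (lagrangian_a m) (lagrangian_a l)
  (lagrangian_b m) (transverse_ba l) _ (transverseC (transverse_ba m))
  (lag_cyc_positive n_gt0 c2) (lag_cyc_positive n_gt0 c3) u0.
case: c3 => _ _ _ tbb _ /(_ tbb).
rewrite [ltRHS]BPQN; lra.
Qed.

Lemma gen_form_add_bound : exists2 e, 0 < e & forall l m u, l != m ->
  gen_form l u u + gen_form m u u <= - (e * `|u| ^+ 2).
Proof.
(* Every small e suits a given pair of letters, so the filter at 0+ yields a common e for the
   finitely many pairs. *)
have near_e : \forall e \near 0^'+, forall (l m : letter g) u, l != m ->
    gen_form l u u + gen_form m u u <= - (e * `|u| ^+ 2).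
  apply: filter_forall => l; apply: filter_forall => m.
  have [->|lm] := eqVneq l m; first by apply: filterE => e u.
  have bB : bilinear_form (fun u v => - (gen_form l u v + gen_form m u v)).
    have [bl bm] := (gen_form_bilinear l, gen_form_bilinear m).
    split=> [v c u w|u c v w] /=.
      by rewrite (bformPl bl) (bformPl bm); ring.
    by rewrite (bformPr bl) (bformPr bm); ring.
  have [|e e0 low] := positive_on_lower_bound (L := fullv) bB.
    by move=> u _ u0; rewrite oppr_gt0; exact: gen_form_add_lt0.
  near=> e' => u _; rewrite lerNr (le_trans _ (low u (memvf u))) //.
  rewrite ler_wpM2r ?sqr_ge0 //.
  by near: e'; exact: nbhs_right_le.
have [e [e0 eP]] : exists e : R, 0 < e /\ forall l m u, l != m ->
    gen_form l u u + gen_form m u u <= - (e * `|u| ^+ 2).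
  by apply: (@filter_ex _ 0^'+); apply: filterI near_e; exact: nbhs_right_gt.
by exists e.
Unshelve. all: by end_near. Qed.

Lemma generated_by_prod (s : seq (letter g)) :
  generated_by A (\prod_(l <- s) letter_val A l)%g.
Proof. by exists s. Qed.

Lemma generated_by_letter l : generated_by A (letter_val A l).
Proof. by exists [:: l]; rewrite big_seq1. Qed.

Lemma generated_by1 : generated_by A 1%g.
Proof. by exists [::]; rewrite big_nil. Qed.

Lemma symplectic_inj (f : 'End(V)) : symplectic omega f -> injective f.
Proof.
move=> sf u v fuv; apply/eqP; rewrite -subr_eq0.
have [/eqP nd _ _] := omega_symplectic.
rewrite -memv0 -nd; apply/mem_orthovP => w _.
have f0 : f (u - v) = 0 by rewrite linearB /= fuv subrr.
by rewrite -sf f0 (bform0l (omega_bilinear omega)).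
Qed.

Lemma letter_valV l : letter_val A (inv_letter l) = ((letter_val A l)^-1)%g.
Proof. by case: l => j [] //=; rewrite /letter_val /= invgK. Qed.

Lemma generated_byM c d :
  generated_by A c -> generated_by A d -> generated_by A (c * d)%g.
Proof. by move=> [s ->] [t ->]; exists (s ++ t); rewrite big_cat. Qed.

(** The morphism property makes [rho 1] idempotent, and a symplectic map is injective. *)
Lemma rho1 : rho 1%g = \1%VF.
Proof.
have g1 := generated_by1.
have inj := symplectic_inj (schottky_symplectic schottky g1).
apply/lfunP => u; apply: inj; rewrite id_lfunE.
rewrite -[in RHS](mulg1 1%g) (schottky_morphism schottky g1 g1).
by rewrite comp_lfunE.
Qed.

Lemma rho_prod_cons l (s : seq (letter g)) u :
  rho (\prod_(m <- l :: s) letter_val A m)%g u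
    = gen l (rho (\prod_(m <- s) letter_val A m)%g u).
Proof.
rewrite big_cons (schottky_morphism schottky) ?comp_lfunE //.
  exact: generated_by_letter.
exact: generated_by_prod.
Qed.

Lemma genK l u : gen (inv_letter l) (gen l u) = u.
Proof.
rewrite -comp_lfunE -(schottky_morphism schottky); try exact: generated_by_letter.
by rewrite letter_valV mulVg rho1 id_lfunE.
Qed.

Lemma genVK l u : gen l (gen (inv_letter l) u) = u.
Proof. by rewrite -{1}[l]inv_letterK genK. Qed.

Lemma gen_symplectic l : symplectic omega (gen l).
Proof. exact: (schottky_symplectic schottky (generated_by_letter l)). Qed.

Lemma gen_img l (P Q : {vspace V}) :
  (gen l @: P)%VS = Q -> (gen (inv_letter l) @: Q)%VS = P.
Proof.
move=> <-; rewrite -limg_comp -[RHS]lim1g; congr (_ @: _)%VS.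
by apply/lfunP => u; rewrite comp_lfunE genK id_lfunE.
Qed.

(** The pairing is assumed for the generators and inverted for the other letters. The swap of a and
    b is the source of the sign in [gen_form_gen]. *)
Lemma gen_endpoints l : (gen l @: xi0 (b (inv_letter l)))%VS = xi0 (a l) /\
  (gen l @: xi0 (a (inv_letter l)))%VS = xi0 (b l).
Proof.
have ra := schottky_rho_a schottky; have rb := schottky_rho_b schottky.
case: l => j [] /=; first by split; [exact: rb|exact: ra].
by split; [apply: (@gen_img (j, true)); exact: ra|apply: (@gen_img (j, true)); exact: rb].
Qed.

Lemma gen_form_gen l u :
  gen_form l (gen l u) (gen l u) = - gen_form (inv_letter l) u u.
Proof.
have [gb ga] := gen_endpoints l.
rewrite -BPQN; apply: BPQ_symplectic => //.
- exact: gen_symplectic.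
- exact: lagrangian_b.
- exact: lagrangian_a.
- exact: transverse_ba.
- exact: lagrangian_a.
- exact: lagrangian_b.
- exact: transverseC (transverse_ba l).
Qed.

(** This is rho(x_0 .. x_(k-1))^-1, composed letter by letter from inverse generators. *)
Fixpoint pullback x k : 'End(V) :=
  if k is k'.+1 then (gen (inv_letter (x k')) \o pullback x k')%VF else \1%VF.

Definition subword x k : PSL2 R := (\prod_(i < k) letter_val A (x i))%g.

Lemma subword_generated x k : generated_by A (subword x k).
Proof.
exists [seq x (val i) | i <- index_enum 'I_k]; rewrite /subword.
by rewrite big_map.
Qed.

Lemma subwordS x k u : rho (subword x k.+1) u = rho (subword x k) (gen (x k) u).
Proof.
rewrite /subword big_ord_recr /= (schottky_morphism schottky) ?comp_lfunE //.
  exact: (subword_generated x k).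
exact: generated_by_letter.
Qed.

Lemma pullbackS x k u : pullback x k.+1 u = gen (inv_letter (x k)) (pullback x k u).
Proof. by rewrite /= comp_lfunE. Qed.

Lemma pullback_subword x k u : pullback x k (rho (subword x k) u) = u.
Proof.
elim: k u => [|k IH] u; first by rewrite /subword big_ord0 rho1 !id_lfunE.
by rewrite subwordS pullbackS IH genK.
Qed.

Lemma subword_pullback x k u : rho (subword x k) (pullback x k u) = u.
Proof.
elim: k u => [|k IH] u; first by rewrite /subword big_ord0 rho1 !id_lfunE.
by rewrite subwordS pullbackS genVK.
Qed.

Lemma pullback_shift x k u :
  pullback x k.+1 u = pullback (x \o succn) k (gen (inv_letter (x 0%N)) u).
Proof.
elim: k => [|k IH]; first by rewrite pullbackS /= !id_lfunE.
by rewrite pullbackS IH [RHS]pullbackS.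
Qed.

Lemma pullback_symplectic x k u v :
  omega (pullback x k u) (pullback x k v) = omega u v.
Proof.
elim: k => [|k IH]; first by rewrite !id_lfunE.
by rewrite !pullbackS gen_symplectic.
Qed.

Lemma pullback_eq0 x k u : (pullback x k u == 0) = (u == 0).
Proof.
apply/eqP/eqP => [h0|->]; last by rewrite linear0.
by rewrite -(subword_pullback x k u) h0 linear0.
Qed.

(* The form attached to the k-th nested interval
   rho(x_0 .. x_(k-1)) (P_(x_k), Q_(x_k)). *)
Definition word_form x k u v : R :=
  gen_form (x k) (pullback x k u) (pullback x k v).

Lemma word_form_bilinear x k : bilinear_form (word_form x k).
Proof.
have bf := gen_form_bilinear (x k).
split=> [v c u w|u c v w]; rewrite /word_form linearP.
  by rewrite (bformPl bf).
by rewrite (bformPr bf).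
Qed.

(** * Decrease of the forms along a reduced word, and stable vectors *)

Definition reduced_word x := forall k, x k.+1 != inv_letter (x k).

Lemma word_form_pullbackS x k u :
  word_form x k u u
    = - gen_form (inv_letter (x k)) (pullback x k.+1 u) (pullback x k.+1 u).
Proof. by rewrite -gen_form_gen pullbackS genVK. Qed.

(** At v = [pullback x k.+1 u] both levels become forms of letters: x_(k+1), and minus that of
    x_k^-1. Reducedness makes these letters distinct. *)
Lemma word_form_decrease : exists2 e, 0 < e & forall x, reduced_word x ->
  forall k u, word_form x k.+1 u u + e * `|pullback x k.+1 u| ^+ 2 <= word_form x k u u.
Proof.
have [e e0 bound] := gen_form_add_bound; exists e => // x red k u.
have := bound _ _ (pullback x k.+1 u) (red k).
rewrite [word_form x k u u]word_form_pullbackS /word_form; lra.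
Qed.

Lemma word_form_nonincreasing x u : reduced_word x ->
  nonincreasing_seq (fun k => word_form x k u u).
Proof.
move=> red; apply/nonincreasing_seqP => k.
have [e e0 dec] := word_form_decrease.
by apply: le_trans (dec x red k u); rewrite lerDl mulr_ge0 ?sqr_ge0 // ltW.
Qed.

Definition stable x u := forall k, 0 <= word_form x k u u.

(** A nonincreasing sequence bounded below converges; its successive differences tend to 0 and
    dominate e times the square norms. *)
Lemma stable_cvg x u : reduced_word x -> stable x u ->
  (fun k => `|pullback x k.+1 u| ^+ 2) @ \oo --> 0.
Proof.
move=> red st; have [e e0 dec] := word_form_decrease.
have : cvgn (fun k => word_form x k u u).
  apply: nonincreasing_is_cvgn; first exact: word_form_nonincreasing.
  by exists 0 => _ [k _ <-].
move=> /cvg_ex[/= c cvgc].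
have cvgSc : (fun k => word_form x k.+1 u u) @ \oo --> c.
    by move: cvgc; rewrite -cvg_shiftS.
have cvg0 : (fun k => e^-1 * (word_form x k u u - word_form x k.+1 u u)) @ \oo --> 0.
  rewrite -(mulr0 e^-1) -(subrr c).
  by apply: cvgM; [exact: cvg_cst|exact: cvgB].
apply: squeeze_cvgr (cvg_cst 0) cvg0.
apply: filterE => k; rewrite sqr_ge0 /=.
rewrite -(ler_pM2l e0) mulVKf ?gt_eqF //; have := dec x red k u; lra.
Qed.

Lemma gen_form_abs_bound : exists2 c, 0 <= c & forall l u,
  `|gen_form l u u| <= c * `|u| ^+ 2.
Proof.
have /choice[f fP] l : exists c, 0 <= c /\
    forall u, `|gen_form l u u| <= c * `|u| ^+ 2.
  have [c c0 bound] := form_bound (gen_form_bilinear l).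
  by exists c; split=> // u; rewrite expr2.
exists (\sum_l f l) => [|l u]; first by apply: sumr_ge0 => l _; case: (fP l).
apply: le_trans (proj2 (fP l) u) _; apply: ler_wpM2r; first exact: sqr_ge0.
by rewrite (bigD1 l) //= lerDl sumr_ge0 // => m _; case: (fP m).
Qed.

(** By monotonicity level k dominates every later level, and those are at least -c times a square
    norm that tends to 0. *)
Lemma cvg_stable x u : reduced_word x ->
  (fun k => `|pullback x k.+1 u| ^+ 2) @ \oo --> 0 -> stable x u.
Proof.
move=> red cvg0 k; have [c c0 bound] := gen_form_abs_bound.
have cvgN : (fun i => - (c * `|pullback x i.+1 u| ^+ 2)) @ \oo --> 0.
  rewrite -[0 in X in _ --> X]oppr0 -(mulr0 c).
  by apply: cvgN; apply: cvgM; [exact: cvg_cst|exact: cvg0].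
apply: (ler_cvg_to cvgN (cvg_cst (word_form x k u u))).
near=> i; have km : (k <= i.+1)%N.
  by apply: leqW; near: i; exact: nbhs_infty_ge.
apply: le_trans (word_form_nonincreasing u red km).
have := bound (x i.+1) (pullback x i.+1 u).
by rewrite ler_norml => /andP[].
Unshelve. all: by end_near. Qed.

Lemma stableP x u : reduced_word x ->
  stable x u <-> (fun k => `|pullback x k.+1 u| ^+ 2) @ \oo --> 0.
Proof. by move=> red; split; [exact: stable_cvg|exact: cvg_stable]. Qed.

Lemma stable_combination x c u v : reduced_word x ->
  stable x u -> stable x v -> stable x (c *: u + v).
Proof.
move=> red /(stableP _ red) su /(stableP _ red) sv; apply/stableP => //.
(* The factors 2 come from (s + t)^2 <= 2 s^2 + 2 t^2. *)
have cvg0 : (fun k => (2 * c ^+ 2) * `|pullback x k.+1 u| ^+ 2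
    + 2 * `|pullback x k.+1 v| ^+ 2) @ \oo --> (2 * c ^+ 2) * 0 + 2 * 0.
  by apply: cvgD; apply: cvgM; first [exact: su | exact: sv | exact: cvg_cst].
rewrite !mulr0 addr0 in cvg0.
apply: squeeze_cvgr (cvg_cst 0) cvg0; apply: filterE => k.
rewrite sqr_ge0 /= linearP.
set p := pullback x k.+1 u; set q := pullback x k.+1 v.
have := ler_normD (c *: p) q; rewrite normrZ => tri.
have : `|c *: p + q| ^+ 2 <= (`|c| * `|p| + `|q|) ^+ 2.
  by rewrite ler_sqr ?nnegrE ?addr_ge0 ?mulr_ge0.
have := sqr_ge0 (`|c| * `|p| - `|q|).
have -> : c ^+ 2 = `|c| ^+ 2 by rewrite real_normK // num_real.
move: (`|c|) (`|p|) (`|q|) => c' p' q'; rewrite !expr2; nra.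
Qed.

Lemma stable_pos x u : reduced_word x -> stable x u -> u != 0 ->
  0 < word_form x 0 u u.
Proof.
move=> red st u0; have [e e0 dec] := word_form_decrease.
apply: lt_le_trans (dec x red 0%N u); rewrite ltr_wpDl ?st //.
by rewrite mulr_gt0 // exprn_gt0 // normr_gt0 pullback_eq0.
Qed.

(* Since [word_form x 0] vanishes on Q_(x_0), a subspace of stable vectors meets
   Q_(x_0) trivially, so its dimension is at most n. *)
Lemma stable_maximal x (E : {vspace V}) : reduced_word x -> \dim E = n ->
  (forall u, u \in E -> stable x u) -> forall u, stable x u -> u \in E.
Proof.
move=> red dE Est u ust; pose E' := (E + <[u]>)%VS.
have E'st w : w \in E' -> stable x w.
  move=> /memv_addP[v vE [z /vlineP[c ->] ->]]; rewrite addrC.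
  by apply: stable_combination => //; exact: Est.
have dQ := (lagrangian_b (x 0%N)).1.
have E'Q : (E' :&: xi0 (b (x 0%N)))%VS = 0%VS.
  apply/eqP; rewrite -subv0; apply/subvP => w.
  rewrite memv_cap memv0 => /andP[/E'st wst wQ].
  apply: contraTT isT => w0; have := stable_pos red wst w0.
  rewrite /word_form id_lfunE BPQ_right0 ?ltxx //; first exact: lagrangian_a.
    exact: lagrangian_b.
  exact: transverseC (transverse_ba _).
have dE' : (\dim E' <= n)%N.
  have := dimvS (subvf (E' + xi0 (b (x 0%N)))).
  rewrite dimv_disjoint_sum // dQ dimvf /dim /= mul1n leq_add2r.
  by [].
have EE' : E == E' by rewrite eqEdim addvSl dE.
by rewrite (eqP EE') memvE addvSr.
Qed.

(** * Base Lagrangians and convergence to the stable subspaces *)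

Lemma base_lagrangiansP L : base_lagrangians omega a b xi0 L <->
  forall l, lag_cyc omega (xi0 (b l)) L (xi0 (a l)).
Proof.
split=> [bL [j c]|bL j _]; last by split; exact: bL.
by have [bt bf] := bL j I; case: c.
Qed.

(** For every m other than l0, [xi0 (b l0)] lies in the interval opposite to that of m. A Lagrangian
    in the opposite of l0, pushed close to [xi0 (b l0)], satisfies all the conditions. *)
Lemma base_lagrangians_nonempty l0 : base_lagrangians omega a b xi0 !=set0.
Proof.
pose C (m : {m : letter g | m != l0}) :=
  BPQ omega (xi0 (b (val m))) (xi0 (a (val m))).
have l1 : l0 != inv_letter l0 by rewrite eq_sym inv_letter_neq.
have [c1 _ _] := lag_cyc_endpoints l1.
have [||L [lL posL CL]] := exists_lagrangian_near (C := C) (lagrangian_b l0)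
  (lagrangian_b (inv_letter l0)) (lagrangian_a l0) (transverse_ba l0)
  (lag_cyc_positive n_gt0 c1).
- by move=> m; exact: BPQ_bilinear.
- move=> m; have [cm _ _] := lag_cyc_endpoints (valP m).
  exact: lag_cyc_positive cm.
exists L; apply/base_lagrangiansP => l; apply: positive_lag_cyc => //.
- exact: lagrangian_b.
- exact: lagrangian_a.
- exact: transverse_ba.
have [->//|ll0] := eqVneq l l0.
exact: (CL (Sub l ll0)).
Qed.

(** At level k - 1 the form, read on L, is that of the opposite interval of x_(k-1)^-1, positive by
    the choice of L; earlier levels are larger. *)
Lemma base_word_form x L j k u : reduced_word x -> base_lagrangians omega a b xi0 L ->
  (j < k)%N -> u \in (rho (subword x k) @: L)%VS -> 0 <= word_form x j u u.
Proof.
move=> red /base_lagrangiansP bL; case: k => // k; rewrite ltnS => jk /memv_imgP[w wL ->].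
apply: le_trans (word_form_nonincreasing (rho (subword x k.+1) w) red jk).
rewrite word_form_pullbackS pullback_subword -BPQN.
have [->|w0] := eqVneq w 0; first by rewrite (bform0l (BPQ_bilinear _ _ _)).
by apply: ltW; exact: (lag_cyc_positive n_gt0 (bL _)).
Qed.

Lemma dim_subword x k (L : {vspace V}) : \dim (rho (subword x k) @: L) = \dim L.
Proof.
apply: limg_dim_eq; apply/eqP; rewrite -subv0; apply/subvP => u.
rewrite memv_cap memv_ker memv0 => /andP[_ /eqP h0].
by rewrite -(pullback_subword x k u) h0 linear0.
Qed.

Definition stable_subspace x (E : {vspace V}) : Prop :=
  lagrangian omega E /\ forall u, u \in E <-> stable x u.

Lemma stable_subspaceI x (E : {vspace V}) : reduced_word x -> \dim E = n ->
  (forall u, u \in E -> stable x u) -> stable_subspace x E.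
Proof.
move=> red dE Est; split; last first.
  by move=> u; split; [exact: Est | exact: stable_maximal Est u].
split=> // u v /Est ust /Est vst.
have [c c0 bound] := form_bound (omega_bilinear omega).
(* Pullbacks preserve omega and shrink both u and v, which forces omega u v to be 0. *)
have cvg0 : (fun k => c * (`|pullback x k.+1 u| ^+ 2
    + `|pullback x k.+1 v| ^+ 2)) @ \oo --> c * (0 + 0).
  apply: cvgM; first exact: cvg_cst.
  by apply: cvgD; exact: stable_cvg.
rewrite addr0 mulr0 in cvg0.
apply/eqP; rewrite -normr_le0; apply: (ler_cvg_to (cvg_cst _) cvg0).
apply: filterE => k /=; rewrite -(pullback_symplectic x k.+1).
apply: le_trans (bound _ _) _; apply: ler_wpM2l => //.
move: (`|pullback x k.+1 u|) (`|pullback x k.+1 v|) => p q.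
have := sqr_ge0 (p - q); have := sqr_ge0 p; have := sqr_ge0 q.
rewrite !expr2; lra.
Qed.

Lemma stable_subspace_unique x (E E' : {vspace V}) :
  stable_subspace x E -> stable_subspace x E' -> E = E'.
Proof.
move=> [_ sE] [_ sE']; apply/vspaceP => u.
by apply/idP/idP => [/sE/sE'|/sE'/sE].
Qed.

Lemma exists_stable_subspace x : reduced_word x -> exists E, stable_subspace x E.
Proof.
move=> red; have [L bL] := base_lagrangians_nonempty (x 0%N).
have dL : \dim L = n by case: ((base_lagrangiansP L).1 bL (x 0%N)) => _ [].
have [||E dE Est] := @exists_limit_subspace R _ nat \oo n
    (fun k => (rho (subword x k) @: L)%VS) (word_form x) _ (word_form_bilinear x).
- by move=> k; rewrite dim_subword.
- move=> j; exists j.+1 => // k jk u; exact: base_word_form.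
exists E; apply: stable_subspaceI => // u uE k; exact: Est.
Qed.

(** The filter is arbitrary: \oo gives the limits defining the boundary map, neighbourhoods in the
    Cantor space give its continuity. *)
Lemma cvg_stable_subspace (T : Type) (F : set_system T) {FF : ProperFilter F}
    (L : T -> grassmannian R (n + n)) x (E : grassmannian R (n + n)) :
  reduced_word x -> stable_subspace x E -> (forall t, \dim (L t) = n) ->
  (forall j, \forall t \near F, forall u, u \in L t -> 0 <= word_form x j u u) ->
  L @ F --> E.
Proof.
move=> red sE dL nonneg.
have cvgP : (fun t => ortho_proj (L t)) @ F --> ortho_proj E.
  apply: (cvg_limit_subspace (word_form_bilinear x) dL nonneg) => E' dE' E'st.
  apply: stable_subspace_unique sE; apply: stable_subspaceI => // u uE' k.
  exact: E'st.
move=> U; rewrite nbhsE => -[B [[C oC CB] BE] BU].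
apply: (@filterS _ F _ ((fun t => ortho_proj (L t)) @^-1` C)).
  by move=> t Ct; apply: BU; rewrite -CB.
by apply: cvgP; apply: open_nbhs_nbhs; split=> //; move: BE; rewrite -CB.
Qed.

(** * The limit set and the orbit of the domain *)

Definition letter_cons l x : nat -> letter g := fun k => if k is k'.+1 then x k' else l.

Lemma stable_shift x u : reduced_word x ->
  stable x u <-> stable (x \o succn) (gen (inv_letter (x 0%N)) u).
Proof.
move=> red; have E k : word_form x k.+1 u u =
    word_form (x \o succn) k (gen (inv_letter (x 0%N)) u) (gen (inv_letter (x 0%N)) u).
  by rewrite /word_form !pullback_shift.
split=> st k; first by rewrite -E.
case: k => [|k]; last by rewrite E.
(* The shift forgets level 0 only, which dominates level 1. *)
by apply: le_trans (word_form_nonincreasing u red (leqnSn 0)); rewrite E.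
Qed.

Definition limit_set : set V :=
  [set u | exists2 x, reduced_word x & stable x u].

(** Applying l to u prepends l to its word, or removes the first letter when that letter is l^-1. *)
Lemma limit_set_gen l u : limit_set u -> limit_set (gen l u).
Proof.
move=> [x red st]; have [xl|xl] := eqVneq (x 0%N) (inv_letter l).
  exists (x \o succn); first by move=> k; exact: red.
  by have /stable_shift := st; rewrite xl inv_letterK; exact.
have redc : reduced_word (letter_cons l x) by case.
exists (letter_cons l x) => //; apply/stable_shift => //=.
by rewrite genK.
Qed.

Lemma line_generator (l : projective_space R (n + n)) :
  exists2 u, u != 0 & sval l = <[u]>%VS.
Proof.
case: l => l /= /eqP dl; exists (vpick l).
  by rewrite vpick0 -dimv_eq0 dl.
apply/esym/eqP; rewrite eqEdim -memvE memv_pick dim_vline vpick0.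
by rewrite -dimv_eq0 dl.
Qed.

Lemma positive_halfspace_line (P Q : {vspace V}) (l : projective_space R (n + n)) u :
  u != 0 -> sval l = <[u]>%VS ->
  positive_halfspace omega P Q l <-> 0 < BPQ omega P Q u u.
Proof.
move=> u0 lE; rewrite /positive_halfspace /= lE; split=> [h|h v].
  by apply: h; rewrite ?memv_line.
move=> /vlineP[c ->]; rewrite scaler_eq0 negb_or => /andP[c0 _].
rewrite (bformZl (BPQ_bilinear _ _ _)) (bformZr (BPQ_bilinear _ _ _)) mulrA.
by rewrite mulr_gt0 // -expr2 exprn_even_gt0.
Qed.

Lemma schottky_domain_line (l : projective_space R (n + n)) u :
  u != 0 -> sval l = <[u]>%VS ->
  schottky_domain omega a b xi0 l <-> forall m, gen_form m u u <= 0.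
Proof.
move=> u0 lE; split=> [Dl [j c]|Dl j _ /=].
  rewrite leNgt; apply/negP => pos; apply: (Dl j I).
  by case: c pos => pos; [left|right]; apply/(positive_halfspace_line _ _ u0 lE).
by case=> /(positive_halfspace_line _ _ u0 lE); rewrite ltNge Dl.
Qed.

(** The vectors spanning lines of rho(Gamma) D, together with 0. *)
Definition vector_orbit : set V :=
  [set u | exists2 c, generated_by A c &
    exists2 w, (forall m, gen_form m w w <= 0) & u = rho c w].

Lemma limit_set_rho c w : generated_by A c -> limit_set (rho c w) -> limit_set w.
Proof.
move=> [s ->]; elim: s => [|l s IH]; first by rewrite big_nil rho1 id_lfunE.
by rewrite rho_prod_cons => /(limit_set_gen (inv_letter l)); rewrite genK.
Qed.

Lemma vector_orbit_gen l u : vector_orbit u -> vector_orbit (gen l u).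
Proof.
move=> [c gc [w Dw ->]]; have gl := generated_by_letter l.
exists (letter_val A l * c)%g; first exact: generated_byM.
by exists w => //; rewrite (schottky_morphism schottky) // comp_lfunE.
Qed.

Lemma vector_orbitP u : u != 0 -> vector_orbit u <-> ~ limit_set u.
Proof.
move=> u0; split=> [[c gc [w Dw uE]]|nlim].
  rewrite uE => /(limit_set_rho gc) [x red st].
  have w0 : w != 0 by apply: contraNneq u0 => w0; rewrite uE w0 linear0.
  (* A nonzero stable vector is positive for its first letter, which the domain forbids. *)
  by have := stable_pos red st w0; rewrite /word_form id_lfunE ltNge Dw.
apply: contrapT => norb; apply: nlim.
have pos_letter v : ~ vector_orbit v -> exists l, 0 < gen_form l v v.
  move=> norbv; apply: contrapT => /forallNP nl; apply: norbv.
  exists 1%g; first exact: generated_by1.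
  exists v; last by rewrite rho1 id_lfunE.
  by move=> m; rewrite leNgt; apply/negP; exact: nl.
have [l0 _] := pos_letter u norb.
have /choice[f fP] v : exists l, ~ vector_orbit v -> 0 < gen_form l v v.
  have [orbv|/pos_letter[l lv]] := pselect (vector_orbit v); last by exists l.
  by exists l0 => /(_ orbv).
pose fix vs k : V := if k is k'.+1 then gen (inv_letter (f (vs k'))) (vs k') else u.
pose x k := f (vs k).
have norbk k : ~ vector_orbit (vs k).
  elim: k => // k IH /= /(vector_orbit_gen (f (vs k))).
  by rewrite genVK.
have red : reduced_word x.
  (* If x_(k+1) were x_k^-1, its form at [vs k.+1] would be minus the form of x_k at [vs k], hence
     negative. *)
  move=> k; apply/eqP => xx; have := fP _ (norbk k.+1).
  rewrite -/(x k.+1) xx -[X in 0 < X]opprK -gen_form_gen /= genVK oppr_gt0.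
  by apply/negP; rewrite -leNgt ltW // fP.
exists x => // k; have -> : word_form x k u u = gen_form (x k) (vs k) (vs k).
  rewrite /word_form; suff -> : pullback x k u = vs k by [].
  by elim: k => [|k IH]; rewrite ?id_lfunE // pullbackS IH.
by apply: ltW; exact: fP.
Qed.

Lemma schottky_orbitE : schottky_orbit A rho (schottky_domain omega a b xi0)
  = [set l : projective_space R (n + n) | forall u, u \in sval l -> u != 0 -> ~ limit_set u].
Proof.
apply/seteqP; split=> l /=.
  move=> [c gc [d Dd ldE]] u.
  have [w w0 dE] := line_generator d.
  rewrite ldE dE limg_line => /vlineP[r ->] ru0; apply/vector_orbitP => //.
  exists c => //; exists (r *: w); last by rewrite linearZ.
  move=> m; have := (schottky_domain_line w0 dE).1 Dd m.
  have bf := gen_form_bilinear m.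
  by rewrite (bformZl bf) (bformZr bf) mulrA -expr2 => /(mulr_ge0_le0 (sqr_ge0 r)).
move=> nlim; have [u u0 lE] := line_generator l.
have /vector_orbitP : ~ limit_set u by apply: nlim => //; rewrite lE memv_line.
case=> // c gc [w Dw uE].
have w0 : w != 0 by apply: contraNneq u0 => w0; rewrite uE w0 linear0.
have dw : \dim <[w]> == 1%N by rewrite dim_vline w0.
exists c => //; exists (exist _ <[w]>%VS dw).
  by apply/(schottky_domain_line w0).
by rewrite lE uE limg_line.
Qed.

(** At the first index where the words differ, the pullbacks of u still agree, and two distinct
    letters would both be nonnegative there, against [gen_form_add_lt0]. *)
Lemma stable_words_disjoint x y u : reduced_word x -> reduced_word y ->
  stable x u -> stable y u -> u != 0 -> x =1 y.
Proof.
move=> redx redy sx sy u0 k; elim/ltn_ind: k => k IH.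
have E : pullback x k u = pullback y k u.
  elim: k IH => [//|k IHk] IH; rewrite !pullbackS IH // IHk // => j jk.
  by rewrite IH // ltnW.
apply/eqP; apply: contraT => xy; have := gen_form_add_lt0 xy.
move=> /(_ (pullback x k u)); rewrite pullback_eq0 => /(_ u0).
have := sx k; have := sy k; rewrite /word_form E; lra.
Qed.

Lemma word_form_congr x y k : (forall j, (j <= k)%N -> x j = y j) ->
  word_form x k = word_form y k.
Proof.
move=> xy; rewrite /word_form xy //.
suff -> : pullback x k = pullback y k by [].
elim: k xy => [//|k IH] xy /=; rewrite xy // IH // => j jk.
by rewrite xy // ltnW.
Qed.

End SchottkyDynamics.

(** * Reduced words and the Cantor space *)

Section CantorCoding.

Lemma injective_hausdorff (T U : topologicalType) (f : T -> U) :
  continuous f -> injective f -> hausdorff_space U -> hausdorff_space T.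
Proof.
move=> cf injf hU p q clpq; apply: injf; apply: hU => B C pB qC.
have [t [Bt Ct]] := clpq _ _ (cf p B pB) (cf q C qC).
by exists (f t).
Qed.

(** A continuous bijection from a compact space to a Hausdorff one is open: the image of a closed
    set is compact, hence closed. *)
Lemma cantor_set_range (U : topologicalType) (f : cantor_space -> U) :
  continuous f -> injective f -> hausdorff_space U -> cantor_set (range f).
Proof.
move=> cf injf hU; have memf z : f z \in range f by apply/mem_set; exists z.
pose F z : set_type (range f) := exist _ (f z) (memf z).
have cF : continuous F.
  move=> z B; rewrite nbhsE => -[C [[D oD DC] Cz] CB].
  apply: (@filterS _ _ _ (f @^-1` D)).
    by move=> z' Dz'; apply: CB; rewrite -DC.
  by apply: cf; apply: open_nbhs_nbhs; split=> //; move: Cz; rewrite -DC.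
have bF : bijective F.
  have surjF y : exists z, F z = y.
    case: y => y yf; have [z _ fz] := set_mem yf.
    by exists z; apply: val_inj.
  have [h hF] := choice surjF.
  exists h => // z; apply: injf; have := congr1 val (hF (F z)).
  by [].
have hK : hausdorff_space (set_type (range f)).
  apply: injective_hausdorff hU; last exact: val_inj.
  exact: initial_continuous.
exists F; split=> // B oB.
have -> : F @` B = ~` (F @` ~` B).
  apply/seteqP; split=> [_ [z Bz <-] [z' nBz' /(bij_inj bF) zz']|y nBy].
    by apply: nBz'; rewrite zz'.
  have [h _ hK'] := bF; exists (h y); last exact: hK'.
  by apply: contrapT => nB; apply: nBy; exists (h y); last exact: hK'.
apply: closed_openC; apply: (compact_closed hK).
apply: (continuous_compact (continuous_subspaceT cF)).
apply: (subclosed_compact _ cantor_space_compact) => //.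
exact: open_closedC.
Qed.

(** The coordinates come from a homeomorphism with the product X, Y, Y, ..; the first factor is
    separate because only the later letters of a reduced word are constrained. *)
Lemma cantor_finite_product (R : realType) (X Y : ptopologicalType) :
  finite_set [set: X] -> finite_set [set: Y] ->
  (exists x x' : X, x != x') -> (exists y y' : Y, y != y') ->
  exists (f0 : cantor_space -> X) (f : nat -> cantor_space -> Y),
  [/\ forall z, \forall z' \near z, f0 z' = f0 z,
      forall k z, \forall z' \near z, f k z' = f k z,
      forall x y, exists z, f0 z = x /\ forall k, f k z = y k &
      forall z z', f0 z = f0 z' -> (forall k, f k z = f k z') -> z = z'].
Proof.
move=> finX finY [x1 [x2 x12]] [y1 [y2 y12]].
pose T (k : nat) : ptopologicalType := if k is 0 then X else Y.
have cT : cantor_like (tree_of T).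
  apply: cantor_like_finite_prod; first by case.
  by case=> [|k]; [exists (x1, x2) | exists (y1, y2)].
have [f [cf _]] := @homeomorphism_cantor_like R (tree_of T) cT.
have near_f k z : \forall z' \near z, f z' k = f z k.
  have cfk : continuous (fun z => proj k (f z) : discrete_topology (T k)).
    move=> z'; apply: continuous_comp; first exact: cf.
    exact: proj_continuous.
  exact: (cfk z _ (discrete_set1 _)).
exists (fun z => f z 0%N), (fun k z => f z k.+1); split.
- by move=> z; exact: (near_f 0%N z).
- by move=> k z; exact: (near_f k.+1 z).
- move=> x y; pose t : tree_of T := fun k => if k is k'.+1 return T k then y k' else x.
  have [z _ fz] := surj (f := f) (I : [set: tree_of T] t).
  by exists z; rewrite fz.
- move=> z z' e0 eS; apply: (inj (f := f)); rewrite ?inE //.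
  by apply: functional_extensionality_dep => -[|k]; [exact: e0|exact: eS].
Qed.

(* Given the letter x_k, the transposition of l0 and (x_k)^-1 identifies the
   letters other than l0 with the letters that may follow x_k. *)
Lemma reduced_word_coding (R : realType) (g : nat) (l0 : letter g) :
  (2 <= g)%N -> exists c : cantor_space -> (nat -> letter g),
  [/\ forall z, reduced_word (c z),
      forall k z, \forall z' \near z, c z' k = c z k,
      forall x, reduced_word x -> exists z, c z = x &
      injective c].
Proof.
move=> g2; pose X : finType := ('I_g * bool)%type; pose Y : finType := {l : X | l != l0}.
have l0V : inv_letter l0 != l0 :> X by exact: inv_letter_neq.
pose pX : pointedType := HB.pack X (isPointed.Build X l0).
pose y0 : Y := Sub (inv_letter l0 : X) l0V.
pose pY : pointedType := HB.pack Y (isPointed.Build Y y0).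
pose tX := HB.pack_for ptopologicalType (discrete_topology pX)
  (Topological.on (discrete_topology pX)) (Pointed.on (discrete_topology pX)).
pose tY := HB.pack_for ptopologicalType (discrete_topology pY)
  (Topological.on (discrete_topology pY)) (Pointed.on (discrete_topology pY)).
have finX : finite_set [set: tX] by exact: (@finite_finset X).
have finY : finite_set [set: tY] by exact: (@finite_finset Y).
have [||f0 [f [near_f0 near_f fsurj finj]]] := @cantor_finite_product R tX tY finX finY.
- by exists l0, (inv_letter l0); rewrite eq_sym; exact: l0V.
(* Both letters on an index other than that of l0 belong to Y; this is where g >= 2 matters. *)
- have [j jl] : exists j, j != l0.1.
    have [l00|] := eqVneq (Ordinal (ltnW g2)) l0.1; last by exists (Ordinal (ltnW g2)).
    by exists (Ordinal g2); rewrite -l00.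
  have jc e : (j, e) != l0 :> X by apply: contraNneq jl => <-.
  exists (Sub (j, true) (jc true) : Y), (Sub (j, false) (jc false) : Y).
  by apply/eqP => /(congr1 (fun y : Y => (val y).2)).
pose swap (l : X) := tperm (l0 : X) (inv_letter l : X).
pose fix c (z : cantor_space) k : X :=
  if k is k'.+1 then swap (c z k') (val (f k' z : Y)) else f0 z.
exists c; split.
- move=> z k /=; rewrite -[X in _ != X](tpermL (l0 : X)) (inj_eq perm_inj).
  exact: (valP (f k z : Y)).
- elim=> [|k IH] z; first exact: near_f0.
  by apply: filterS2 (IH z) (near_f k z) => z' /= -> ->.
- move=> x red.
  have xl k : swap (x k) (x k.+1) != l0.
    rewrite -[X in _ != X](tpermR (l0 : X) (inv_letter (x k) : X)) (inj_eq perm_inj).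
    exact: red.
  have [z [z0 zS]] := fsurj (x 0%N) (fun k => Sub (swap (x k) (x k.+1)) (xl k) : Y).
  exists z; apply/funext; elim=> [|k IH] /=; first exact: z0.
  by rewrite IH zS /= tpermK.
move=> z z' cc; apply: finj; first exact: (congr1 (fun x => x 0%N) cc).
move=> k; apply: val_inj; apply: (@perm_inj _ (swap (c z k))).
have := congr1 (fun x => x k.+1) cc; rewrite /= => ->.
by rewrite cc.
Qed.

End CantorCoding.

(** * The boundary map and its Cantor set *)

Lemma grassmannian_hausdorff (R : realType) (N : nat) :
  hausdorff_space (grassmannian R N).
Proof.
apply: (@injective_hausdorff (grassmannian R N) 'M[R]_N (@ortho_proj R N)).
- exact: (@initial_continuous _ _ (@ortho_proj R N)).
- exact: ortho_proj_inj.
- exact: norm_hausdorff.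
Qed.

Theorem theorem4 (R : realType) (n : nat) (n_ge1 : (1 <= n)%N)
    (omega : {skew_symmetric 'rV[R]_(n + n)})
    (omega_symplectic : is_psymplectic omega)
    (g : nat) (g_ge2 : (2 <= g)%N) (A : 'I_g -> PSL2 R)
    (a b : letter g -> circle R) (xi0 : circle R -> {vspace 'rV[R]_(n + n)})
    (rho : PSL2 R -> 'End('rV[R]_(n + n)))
    (schottky : generalized_schottky omega A a b xi0 rho) :
  exists eta : boundary g -> grassmannian R (n + n),
    [/\ boundary_map omega A a b xi0 rho eta,
        cantor_set (range eta) &
        schottky_orbit A rho (schottky_domain omega a b xi0)
          = ~` \bigcup_(x in [set: boundary g]) projectivization (eta x)].
Proof.
pose l0 : letter g := (Ordinal (ltnW g_ge2), true).
have /choice[eta etaP] (x : boundary g) : exists E : grassmannian R (n + n),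
    stable_subspace omega A a b xi0 rho (sval x) E.
  exact: (exists_stable_subspace omega_symplectic n_ge1 schottky (svalP x)).
exists eta; split.
- split.
  + exact: (base_lagrangians_nonempty n_ge1 schottky l0).
  + by move=> x; case: (etaP x).
  + move=> x L bL.
    have bL' := (base_lagrangiansP omega a b xi0 L).1 bL.
    apply: (cvg_stable_subspace omega_symplectic n_ge1 schottky (svalP x) (etaP x)).
      move=> k; rewrite (dim_subword omega_symplectic schottky).
      by case: (bL' l0) => _ [].
    move=> j; exists j.+1 => // k jk u.
    exact: (base_word_form omega_symplectic n_ge1 schottky (svalP x) bL jk).
- have [c [red near_c csurj cinj]] := reduced_word_coding R l0 g_ge2.
  pose xc z : boundary g := exist _ (c z) (red z).
  have xcE z x : c z = sval x -> xc z = x.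
    case: x => x rx /= zx; rewrite /xc; move: (red z); rewrite zx => rx'.
    by congr exist; exact: Prop_irrelevance.
  have -> : range eta = range (eta \o xc).
    apply/seteqP; split=> _ [x _ <-]; last by exists (xc x).
    have [z zx] := csurj _ (svalP x); exists z => //=; congr eta.
    exact: xcE.
  have cvg_eta (z : cantor_space) : (eta \o xc) @ z --> eta (xc z).
    apply: (cvg_stable_subspace omega_symplectic n_ge1 schottky
      (red z) (etaP (xc z))).
      by move=> z' /=; case: (etaP (xc z')) => -[].
    (* Level j depends only on the first j + 1 letters, which are locally constant on the Cantor
       space. *)
    move=> j; have near_le : nbhs z [set z' | forall i : 'I_j.+1, c z' i = c z i].
      have Fz := nbhs_filter z.
      apply: (@filter_forall _ _ (fun (i : 'I_j.+1) z' => c z' i = c z i) _ Fz).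
      by move=> i; exact: near_c.
    apply: (@filterS _ (nbhs z) _ _ _ _ near_le).
    move=> z' /= czz u /((etaP (xc z')).2 u).1 /(_ j) /=.
    rewrite (@word_form_congr _ _ _ _ _ _ _ _ _ (c z') (c z)) // => i ij.
    exact: (czz (Ordinal (ij : (i < j.+1)%N))).
  apply: cantor_set_range.
  + move=> z; exact: cvg_eta.
  + move=> z z' /= ee; apply: cinj; apply/funext.
    have [[dE _] stE] := etaP (xc z).
    (* As n >= 1, equal images share a nonzero vector, stable for both words. *)
    have u0 : vpick (eta (xc z)) != 0.
      by rewrite vpick0 -dimv_eq0 dE -lt0n.
    apply: (stable_words_disjoint omega_symplectic n_ge1 schottky (red z) (red z') _ _ u0).
      exact: ((etaP (xc z)).2 _).1 (memv_pick _).
    by apply: ((etaP (xc z')).2 _).1; rewrite -ee memv_pick.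
  + exact: grassmannian_hausdorff.
rewrite (schottky_orbitE omega_symplectic n_ge1 schottky).
apply/seteqP; split=> l /=.
  move=> nlim [x _ /subvP lx]; have [u u0 lE] := line_generator l.
  have ul : u \in sval l by rewrite lE memv_line.
  apply: (nlim u ul u0); exists (sval x); first exact: (svalP x).
  by apply/(etaP x).2; exact: lx.
move=> nl u ul u0 [x red st]; apply: nl; exists (exist _ x red) => //=.
(* A single nonzero stable vector spans its line, so the whole line lies in the subspace. *)
have [v v0 lE] := line_generator l.
move: ul; rewrite lE => /vlineP[r ur].
have r0 : r != 0 by apply: contraNneq u0 => r0; rewrite ur r0 scale0r.
rewrite /projectivization /= lE -memvE -(scalerK r0 v) -ur memvZ //.
by apply/(etaP _).2.
Qed.
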